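(* Every quitting game $\Gamma((r^S)_{S\subseteq I})$ admits a sunspot $\varepsilon$-equilibrium, for every $\varepsilon>0$.
   Context: A quitting game $\Gamma((r^S)_{S\subseteq I})$ consists of a finite set of players $I=[N]=\{1,\dots,N\}$ and, for every subset $S\subseteq I$ (including $S=\emptyset$), a vector $r^S\in[-1,1]^N$. At every stage $t\in\mathbb N$ each player decides whether to continue or to quit. Let $t^*$ be the first stage at which at least one player quits and $S^*$ the set of players who quit at stage $t^*$; if no player ever quits, $t^*=\infty$ and $S^*=\emptyset$. The payoff vector is $r^{S^*}$. Write $r^i:=r^{\{i\}}$. Sunspot version: at the beginning of every stage $t$ the players publicly observe a signal $s^t\in[0,1]$, drawn from the uniform distribution independently of past signals and play. A strategy of player $i$ is a sequence $\xi_i=(\xi_i^t)_{t\in\mathbb N}$ of measurable functions $\xi_i^t:[0,1]^t\to[0,1]$, where $\xi_i^t(s^1,\dots,s^t)$ is the probability that player $i$ quits at stage $t$ if no player quit before stage $t$ (players randomize independently given the signals). For a profile $\xi$, $\gamma(\xi):=\mathbb E_\xi[r^{S^*}]$. A profile $\xi$ is a sunspot $\varepsilon$-equilibrium if $\gamma_i(\xi)\ge\gamma_i(\xi_i',\xi_{-i})-\varepsilon$ for every player $i$ and every strategy $\xi_i'$ of player $i$ in this extended game. *)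

(* Defs.v *)
From HB Require Import structures.
From mathcomp Require Import all_boot all_order all_algebra.
From mathcomp Require Import all_classical all_reals all_analysis.
Set Implicit Arguments. Unset Strict Implicit. Unset Printing Implicit Defensive.
Import Order.TTheory GRing.Theory Num.Theory.
Import numFieldNormedType.Exports.
Local Open Scope classical_set_scope.
Local Open Scope ring_scope.

Section QuittingGame.
Variable R : realType.

(* Stages are indexed from 0: stage t (0-based) is the paper's stage t+1.
   A sunspot strategy of a player is, for each stage t, a function of the
   t+1 public signals observed so far (s^1,...,s^{t+1}), giving the
   probability of quitting at that stage. *)
Definition strat := forall t : nat, (t.+1).-tuple R -> R.

(* validity: measurable in the signals (product Borel sigma-algebra on
   tuples) and [0,1]-valued *)
Definition valid_strat (x : strat) : Prop :=
  forall t : nat, measurable_fun [set: (t.+1).-tuple R] (x t) /\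
                  forall h, 0 <= x t h <= 1.

Variable N : nat.
Definition profile := 'I_N -> strat.
Definition valid_profile (xi : profile) : Prop := forall i, valid_strat (xi i).

Definition hist (s : nat -> R) (t : nat) : (t.+1).-tuple R :=
  [tuple s (nat_of_ord i) | i < t.+1].

Definition qprob (xi : profile) (i : 'I_N) (t : nat) (s : nat -> R) : R :=
  xi i t (hist s t).

Definition survive (xi : profile) (t : nat) (s : nat -> R) : R :=
  \prod_(u < t) \prod_(i < N) (1 - qprob xi i u s).

Definition stopS (xi : profile) (t : nat) (S : {set 'I_N}) (s : nat -> R) : R :=
  survive xi t s * (\prod_(i in S) qprob xi i t s)
                 * (\prod_(i in ~: S) (1 - qprob xi i t s)).

Definition scons (x : R) (s : nat -> R) : nat -> R :=
  fun n => if n is n'.+1 then s n' else x.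

(* expectation over the first k signals, i.i.d. uniform on [0,1]
   (iterated Lebesgue integrals over [0,1]); remaining coordinates set to 0 *)
Fixpoint Esig (k : nat) (g : (nat -> R) -> R) : R :=
  match k with
  | 0 => g (fun _ => 0)
  | k'.+1 => Rintegral (@lebesgue_measure R) `[0, 1]
               (fun x => Esig k' (fun s => g (scons x s)))
  end.

(* unconditional probability that play stops at stage t with quitters S;
   stopS xi t S depends only on the first t+1 signals *)
Definition pstop (xi : profile) (t : nat) (S : {set 'I_N}) : R :=
  Esig t.+1 (stopS xi t S).

Definition gamma_trunc (r : {set 'I_N} -> 'I_N -> R) (xi : profile) (j : 'I_N)
    (n : nat) : R :=
  \sum_(t < n) \sum_(S : {set 'I_N} | S != finset.set0) pstop xi t S * r S j
  + (1 - \sum_(t < n) \sum_(S : {set 'I_N} | S != finset.set0) pstop xi t S) * r finset.set0 j.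

(* expected payoff gamma_j(xi) = E[r^{S*}_j]: the limit of the truncations *)
Definition gamma (r : {set 'I_N} -> 'I_N -> R) (xi : profile) (j : 'I_N) : R :=
  lim (gamma_trunc r xi j @ \oo).

Definition deviate (xi : profile) (j : 'I_N) (eta : strat) : profile :=
  fun i => if i == j then eta else xi i.

Definition sunspot_eq (r : {set 'I_N} -> 'I_N -> R) (eps : R) (xi : profile) : Prop :=
  valid_profile xi /\
  forall (j : 'I_N) (eta : strat), valid_strat eta ->
    gamma r (deviate xi j eta) j - eps <= gamma r xi j.

End QuittingGame.

(* Main.v *)
(** Shift the payoffs so that quitting alone pays 0.  A profile is built backwards
    from an end at which everybody continues forever, together with a vector u:
    no deviation earns more than u (up to e), and obeying earns u except on the
    event that play reaches the end.

    As long as some player i has u_i close to 0 and u >= - slack, precede the play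
    by a stage at which i quits with small probability theta: u moves to
    theta r^i + (1 - theta) u, player i is indifferent, the others gain at most
    about slack by quitting first, and the probability of reaching the end is
    multiplied by 1 - theta.  When a coordinate is about to drop below - slack,
    precede the play instead by a stationary phase: a mixed action x is repeated
    until a public signal of probability lam switches to the continuation u, where
    x is an approximate equilibrium of this auxiliary game (Kuhn's cubical form of
    Sperner's lemma).  Either the phase nearly always ends the game before the
    signal, and the profile is already an equilibrium, or x is tiny.  In the latter
    case quitting pays about 0, so the value V of the phase is almost nonnegative;
    and x <> 0, because u has a negative coordinate, so V_i is close to 0 for some
    player i who quits, and the first kind of stage applies again.  Since u is
    always an exact expectation, the errors slack + 2 theta do not accumulate. *)

Require Import Defs.
From HB Require Import structures.
From mathcomp Require Import all_boot all_order all_algebra.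
From mathcomp Require Import all_classical all_reals all_analysis.
From mathcomp Require Import measurable_realfun ring lra.
Set Implicit Arguments. Unset Strict Implicit. Unset Printing Implicit Defensive.
Import Order.TTheory GRing.Theory Num.Theory.
Import numFieldNormedType.Exports.
Local Open Scope ring_scope.

(** * Kuhn's cubical form of Sperner's lemma, by a cup product mod 2 *)

Section Kuhn.
Variable I : finType.
Implicit Types (v w : {ffun I -> nat}) (A B : {set I}).
Implicit Types (F G : {ffun I -> nat} -> 'F_2) (cs : seq I).

Definition inc v (a : I) : {ffun I -> nat} := [ffun i => (v i + (i == a))%N].
Definition upd v (c : I) (k : nat) : {ffun I -> nat} :=
  [ffun i => if i == c then k else v i].

Lemma addF2 (x : 'F_2) : x + x = 0.
Proof. by rewrite -mulr2n mulrn_pchar // pchar_Fp. Qed.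

Lemma oppF2 (x : 'F_2) : - x = x.
Proof. by apply/eqP; rewrite eq_sym -addr_eq0 addF2. Qed.

Lemma incC v a b : inc (inc v a) b = inc (inc v b) a.
Proof. by apply/ffunP => i; rewrite !ffunE addnAC. Qed.

(** Each unordered pair of directions is counted twice, and 1 + 1 = 0 in ['F_2]. *)
Lemma sum_offdiag_sym (G : I -> I -> 'F_2) B : (forall a c, G a c = G c a) ->
  \sum_(a in B) \sum_(c in B :\ a) G a c = 0.
Proof.
move=> sG; have [m] := ubnP #|B|; elim: m B => // m IH B ltm.
have [->|/set0Pn[b bB]] := eqVneq B finset.set0; first by rewrite big_set0.
rewrite (big_setD1 b) //=.
have -> : \sum_(i in B :\ b) \sum_(c in B :\ i) G i c =
   \sum_(i in B :\ b) G b i + \sum_(i in B :\ b) \sum_(c in (B :\ b) :\ i) G i c.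
  rewrite -big_split /=; apply: eq_bigr => i; rewrite !inE => /andP[ib iB].
  rewrite (big_setD1 b) /=; last by rewrite !inE eq_sym ib.
  by rewrite sG finset.setDDl finset.setUC -finset.setDDl.
rewrite addrA addF2 add0r IH //.
by move: ltm; rewrite (cardsD1 b) bB ltnS.
Qed.

(** The coordinates in [cs] stop at p - 1 because they index the lower corners of the cells of the
    grid with vertices 0, ..., p. *)
Fixpoint box p (cs : seq I) (F : {ffun I -> nat} -> 'F_2) v : 'F_2 :=
  if cs is c :: cs' then \sum_(k < p) box p cs' F (upd v c k) else F v.

Lemma eq_box p cs F G v :
  (forall w, (forall i, i \notin cs -> w i = v i) -> F w = G w) ->
  box p cs F v = box p cs G v.
Proof.
elim: cs v => [|c cs IH] v FG /=; first exact: FG.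
apply: eq_bigr => k _; apply: IH => w hw; apply: FG => i.
by rewrite inE negb_or => /andP[ic ics]; rewrite hw // ffunE (negbTE ic).
Qed.

Lemma box_sum p cs (J : finType) (P : pred J) (F : J -> {ffun I -> nat} -> 'F_2) v :
  box p cs (fun w => \sum_(j | P j) F j w) v = \sum_(j | P j) box p cs (F j) v.
Proof.
elim: cs v => [//|c cs IH] v /=; rewrite exchange_big /=.
by apply: eq_bigr => k _; rewrite IH.
Qed.

Lemma boxB p cs F G v :
  box p cs (fun w => F w - G w) v = box p cs F v - box p cs G v.
Proof.
elim: cs v => [//|c cs IH] v /=.
by rewrite -sumrB; apply: eq_bigr => k _; rewrite IH.
Qed.

Lemma box_inc p cs a F v : a \notin cs ->
  box p cs (fun w => F (inc w a)) v = box p cs F (inc v a).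
Proof.
elim: cs v => [//|c cs IH] v /=; rewrite inE negb_or => /andP[ac acs].
apply: eq_bigr => k _; rewrite IH //; congr box; apply/ffunP => i; rewrite !ffunE.
by have [->|//] := eqVneq i c; rewrite eq_sym (negbTE ac) addn0.
Qed.

Lemma box_telescope p c cs F v : c \notin cs ->
  box p (c :: cs) (fun w => F (inc w c) - F w) v =
  box p cs F (upd v c p) - box p cs F (upd v c 0).
Proof.
move=> ccs /=; rewrite -(big_mkord xpredT (fun k =>
  box p cs (fun w => F (inc w c) - F w) (upd v c k))).
rewrite (eq_bigr (fun k => box p cs F (upd v c k.+1) - box p cs F (upd v c k))).
  by rewrite telescope_sumr.
move=> k _; rewrite boxB box_inc //; congr (box _ _ _ _ - _).
by apply/ffunP => i; rewrite !ffunE; case: (i == c); rewrite ?addn0 ?addn1.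
Qed.

(** Along [a] the differences telescope to the two end faces of the grid, where [F] vanishes. *)
Lemma box_telescope0 p cs a F v : a \in cs -> uniq cs ->
  (forall w, w a = 0%N \/ w a = p -> F w = 0) ->
  box p cs (fun w => F (inc w a) - F w) v = 0.
Proof.
move=> + + F0; elim: cs v => [//|c cs IH] v.
rewrite inE /= => + /andP[ccs ucs].
have [eac _|ac /= acs] := eqVneq a c; last first.
  by rewrite big1 // => k _; rewrite IH.
rewrite -{c}eac in ccs *.
have z k : k = 0%N \/ k = p -> box p cs F (upd v a k) = 0.
  move=> hk; rewrite (@eq_box _ _ _ (fun=> 0)); last first.
    by move=> w hw; apply: F0; rewrite hw // ffunE eqxx.
  by elim: (cs) (upd _ _ _) => //= ? s IHs u; rewrite big1.
by have /= -> := box_telescope p F v ccs; rewrite !z ?subr0 //; [left | right].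
Qed.

Lemma box_neq0 p cs F v : box p cs F v != 0 ->
  exists2 w : {ffun I -> nat}, (forall i, i \in cs -> (w i < p)%N) & F w != 0.
Proof.
suff H : box p cs F v != 0 -> exists w : {ffun I -> nat}, [/\ forall i, i \in cs -> (w i < p)%N,
    forall i, i \notin cs -> w i = v i & F w != 0].
  by move=> /H[w [? _ ?]]; exists w.
elim: cs v => [|c cs IH] v /=; first by exists v.
move=> nz; have [k kp] : exists2 k : 'I_p, true & box p cs F (upd v c k) != 0.
  apply/exists_inP; apply: contraNT nz; rewrite negb_exists => /forallP nz.
  by rewrite big1 // => k _; apply/eqP; move: (nz k); rewrite negbK.
move=> /IH[w [wp wv Fw]]; exists w; split=> // i; rewrite inE.
  have [->|_] := eqVneq i c; last exact: wp.
  by have [/wp//|cs'] := boolP (c \in cs); rewrite wv // ffunE eqxx.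
by rewrite negb_or => /andP[ic ics]; rewrite wv // ffunE (negbTE ic).
Qed.

Section Labels.
Variable f : I -> {ffun I -> nat} -> 'F_2.

(* The cup product of the coboundaries of the labels listed in fs, evaluated
   mod 2 and summed over the monotone lattice paths that start at v and use each
   direction of A at most once. *)
Fixpoint chain (fs : seq I) A v : 'F_2 :=
  if fs is c :: fs' then
    \sum_(a in A) (f c (inc v a) - f c v) * chain fs' (A :\ a) (inc v a)
  else 1.

(** A cup product of coboundaries is a cocycle. After expanding the first step of the paths on both
    sides, terms symmetric in two directions cancel mod 2 and the rest agree by induction. *)
Lemma chain_closed fs B v :
  \sum_(a in B) chain fs (B :\ a) (inc v a) = \sum_(a in B) chain fs (B :\ a) v.
Proof.
elim: fs B v => [//|l fs IH] B v /=.
pose S u := \sum_(a in B) f l (inc u a) * \sum_(c in B :\ a) chain fs (B :\ a :\ c) (inc u a).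
have swap (F : I -> I -> {ffun I -> nat} -> 'F_2) :
    \sum_(a in B) \sum_(c in B :\ a) F a c v = \sum_(c in B) \sum_(a in B :\ c) F a c v.
  rewrite (exchange_big_dep (mem B)) /=; last by move=> a c _; rewrite !inE => /andP[].
  apply: eq_bigr => c cB; apply: eq_bigl => a.
  by rewrite !inE cB andbT eq_sym andbC.
have setDC a c : B :\ a :\ c = B :\ c :\ a by rewrite !finset.setDDl finset.setUC.
transitivity (S v).
  transitivity (\sum_(a in B) \sum_(c in B :\ a)
     f l (inc (inc v a) c) * chain fs (B :\ a :\ c) (inc (inc v a) c)
   + \sum_(a in B) \sum_(c in B :\ a)
     f l (inc v a) * chain fs (B :\ a :\ c) (inc (inc v a) c)).
    rewrite -big_split; apply: eq_bigr => a _; rewrite -big_split.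
    by apply: eq_bigr => c _; rewrite mulrBl oppF2.
  rewrite sum_offdiag_sym ?add0r; last by move=> a c; rewrite incC setDC.
  apply: eq_bigr => a _; rewrite -mulr_sumr; congr (_ * _); exact: IH.
transitivity (\sum_(a in B) \sum_(c in B :\ a)
     f l (inc v c) * chain fs (B :\ a :\ c) (inc v c)
   + \sum_(a in B) \sum_(c in B :\ a)
     f l v * chain fs (B :\ a :\ c) (inc v c)); last first.
  rewrite -big_split; apply: eq_bigr => a _; rewrite -big_split.
  by apply: eq_bigr => c _; rewrite mulrBl oppF2.
rewrite (swap (fun a c v => f l (inc v c) * chain fs (B :\ a :\ c) (inc v c))).
rewrite (_ : \sum_(a in B) \sum_(c in B :\ a) f l v * _ = 0) ?addr0.
  apply: eq_bigr => a _; rewrite mulr_sumr; apply: eq_bigr => c _.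
  by rewrite setDC.
transitivity (\sum_(a in B) \sum_(c in B :\ a) f l v * chain fs (B :\ a :\ c) v).
  by apply: eq_bigr => a _; rewrite -!mulr_sumr IH.
by rewrite sum_offdiag_sym // => a c; rewrite setDC.
Qed.

(** A path in directions of [A] stays in the hyperplane where coordinate [a] equals [k]; label [l]
    is constant there, so its factor is 0 in every term. *)
Lemma chain_face l (fs : seq I) A v a k : l \in fs -> a \notin A -> v a = k ->
  (forall u w : {ffun I -> nat}, u a = k -> w a = k -> f l u = f l w) -> chain fs A v = 0.
Proof.
move=> + + + hf; elim: fs A v => [//|g fs IH] A v + aA vk /=.
have ik b : b \in A -> inc v b a = k.
  move=> bA; rewrite ffunE vk (_ : (a == b) = false) ?addn0 //.
  by apply: contraNF aA => /eqP->.
rewrite inE => /predU1P[<-|ffs]; rewrite big1 // => b bA.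
  by rewrite (hf _ v) ?subrr ?mul0r // ik.
by rewrite IH ?mulr0 ?ik // !inE (negbTE aA) andbF.
Qed.

Variable p : nat.
Hypothesis f0 : forall c (v : {ffun I -> nat}), v c = 0%N -> f c v = 0.
Hypothesis fp : forall c (v : {ffun I -> nat}), v c = p -> f c v = 1.

(* Discrete Stokes: the sum over the box only depends on the boundary values. *)
Lemma box_chain cs v : uniq cs ->
  box p cs (chain cs [set x in cs]) v = 1.
Proof.
elim: cs v => [//|c cs IH] v /= /andP[ccs ucs].
set A := [set x in c :: cs]; rewrite -/(box p (c :: cs) _ _).
pose h a w := f c w * chain cs (A :\ a) w.
(* Integration by parts: since [chain cs] is closed, the integrand is the coboundary of [f c] times
   [chain cs]. *)
rewrite (@eq_box _ _ _ (fun w => \sum_(a in A) (h a (inc w a) - h a w))); last first.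
  move=> w _; rewrite sumrB /h -mulr_sumr -chain_closed mulr_sumr -sumrB.
  by apply: eq_bigr => a _; rewrite mulrBl.
rewrite box_sum (big_setD1 c) /=; last by rewrite !inE eqxx.
have AD : A :\ c = [set x in cs].
  apply/setP => x; rewrite !inE; have [->|//] := eqVneq x c.
  by rewrite (negbTE ccs).
(* In direction [c] the end faces remain: [f c] is 1 at [p], which leaves the box sum for [cs], and
   0 at 0. In any other direction [a] the label of [a] is constant on each end face, so [chain_face]
   applies. *)
rewrite -/(box p (c :: cs) _ _) box_telescope // big1 ?addr0; last first.
  move=> a; rewrite AD inE => acs; rewrite -/(box p (c :: cs) _ _).
  apply: box_telescope0; rewrite ?inE ?acs ?orbT //= ?ccs //.
  move=> w wa; rewrite /h (@chain_face a _ _ _ a (w a)) ?mulr0 //.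
    by rewrite !inE eqxx.
  move=> u u' ua u'a; case: wa => wa; rewrite wa in ua u'a.
    by rewrite !f0.
  by rewrite !fp.
rewrite (@eq_box _ _ _ (chain cs [set x in cs])) ?IH; last first.
- by move=> w hw; rewrite /h fp ?mul1r ?AD // hw // ffunE eqxx.
- done.
rewrite (@eq_box _ _ _ (fun=> 0)); last first.
  by move=> w hw; rewrite /h f0 ?mul0r // hw // ffunE eqxx.
suff -> : box p cs (fun=> 0) (upd v c 0) = 0 by rewrite subr0.
by elim: (cs) (upd _ _ _) => //= ? s IHs u; rewrite big1.
Qed.

(** A nonzero term is a path inside the cell with one step for each label of [fs], across which that
    label changes; [w] and [w'] are the ends of that step. *)
Lemma chain_neq0 fs A v : chain fs A v != 0 -> forall c, c \in fs ->
  exists w w' : {ffun I -> nat}, [/\ f c w != f c w', forall i, (v i <= w i <= v i + (i \in A))%N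
                 & forall i, (v i <= w' i <= v i + (i \in A))%N].
Proof.
elim: fs A v => [//|l fs IH] A v /= nz.
have [a aA] : exists2 a, a \in A & (f l (inc v a) - f l v) * chain fs (A :\ a) (inc v a) != 0.
  apply/exists_inP; apply: contraNT nz; rewrite negb_exists => /forallP nz.
  rewrite big1 // => a aA; apply/eqP; move: (nz a); rewrite aA /=.
  by rewrite negbK.
rewrite mulf_eq0 negb_or subr_eq0 => /andP[fa /IH{}IH] c.
rewrite inE => /predU1P[->|/IH[w [w' [gw lw lw']]]].
  exists (inc v a), v; split=> // i; rewrite ?leq_addr ?leqnn // !ffunE.
  by rewrite leq_addr leq_add2l; case: eqP => // ->; rewrite aA.
have le i : (v i <= inc v a i)%N by rewrite ffunE leq_addr.
have le2 i : (inc v a i + (i \in A :\ a) <= v i + (i \in A))%N.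
  by rewrite ffunE !inE -addnA leq_add2l; case: eqP => //= ->; rewrite aA.
exists w, w'; split=> // i.
  by move: (lw i) => /andP[l1 l2]; rewrite (leq_trans (le i) l1) (leq_trans l2).
by move: (lw' i) => /andP[l1 l2]; rewrite (leq_trans (le i) l1) (leq_trans l2).
Qed.

End Labels.

(** The chain sums to 1 over the grid, so it is nonzero at some cell [b], and every label changes
    along a path inside that cell. *)
Lemma kuhn p (l : I -> {ffun I -> nat} -> bool) :
  (forall c (v : {ffun I -> nat}), v c = 0%N -> l c v = false) ->
  (forall c (v : {ffun I -> nat}), v c = p -> l c v = true) ->
  exists2 b : {ffun I -> nat}, forall i, (b i < p)%N & forall c, exists w w',
    [/\ l c w = false, l c w' = true, forall i, (b i <= w i <= (b i).+1)%N
      & forall i, (b i <= w' i <= (b i).+1)%N].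
Proof.
move=> l0 lp; pose f c v : 'F_2 := (l c v)%:R.
have f0 c v : v c = 0%N -> f c v = 0 by move=> /l0 E; rewrite /f E.
have fp c v : v c = p -> f c v = 1 by move=> /lp E; rewrite /f E.
have := @box_chain f p f0 fp (enum I) [ffun=> 0%N] (enum_uniq I).
move=> /eqP E; have /box_neq0[b bp] : box p (enum I)
    (chain f (enum I) [set x in enum I]) [ffun=> 0%N] != 0.
  by rewrite (eqP E) oner_neq0.
move=> /chain_neq0 H; exists b => [i|c]; first by apply: bp; rewrite mem_enum.
have [w [w' [fw lw lw']]] := H c (mem_enum _ c).
have le u : (forall i, (b i <= u i <= b i + (i \in [set x in enum I]))%N) ->
    forall i, (b i <= u i <= (b i).+1)%N.
  move=> h i; have /andP[-> /=] := h i; move/leq_trans; apply.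
  by rewrite -addn1 leq_add2l leq_b1.
move: fw; rewrite /f; case E1: (l c w); case E2: (l c w') => // _.
  by exists w', w; split=> //; exact: le.
by exists w, w'; split=> //; exact: le.
Qed.
End Kuhn.

(** * Lipschitz functions on the cube and approximate complementarity *)

Section Lipschitz.
Variables (R : realType) (I : finType).
Implicit Types (x y : I -> R) (f g : (I -> R) -> R).

Definition in_cube x := forall i, 0 <= x i <= 1.

Definition subst x (j : I) (a : R) : I -> R := fun i => if i == j then a else x i.

Lemma in_cube_subst x j a : in_cube x -> 0 <= a <= 1 -> in_cube (subst x j a).
Proof. by move=> cx a01 i; rewrite /subst; case: ifP. Qed.

(** The sup norm is meant; [d] is any bound on the distance, so no norm on [I -> R] has to be set
    up. *)
Definition lip f := exists2 L : R, 0 <= L & forall x y (d : R), in_cube x -> in_cube y ->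
  0 <= d -> (forall i, `|x i - y i| <= d) -> `|f x - f y| <= L * d.

Lemma lip_cst c : lip (fun=> c).
Proof. by exists 0 => // x y d *; rewrite subrr normr0 mul0r. Qed.

Lemma lip_proj i : lip (fun x => x i).
Proof. by exists 1 => // x y d *; rewrite mul1r. Qed.

Lemma lipD f g : lip f -> lip g -> lip (fun x => f x + g x).
Proof.
move=> [L L0 fL] [M M0 gM]; exists (L + M); first exact: addr_ge0.
move=> x y d cx cy d0 xy; rewrite opprD addrACA mulrDl.
by rewrite (le_trans (ler_normD _ _)) // lerD ?fL ?gM.
Qed.

Lemma lip_bounded f : lip f -> exists2 M : R, 0 <= M & forall x, in_cube x -> `|f x| <= M.
Proof.
move=> [L L0 fL]; exists (`|f (fun=> 0)| + L); first exact: addr_ge0.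
move=> x cx; rewrite -[f x](subrK (f (fun=> 0))) (le_trans (ler_normD _ _)) //.
rewrite addrC lerD2l -[leRHS]mulr1 fL // => i; first by rewrite lexx ler01.
by have /andP[x0 x1] := cx i; rewrite subr0 ger0_norm.
Qed.

Lemma lipM f g : lip f -> lip g -> lip (fun x => f x * g x).
Proof.
move=> lf lg; have [Mf Mf0 fM] := lip_bounded lf; have [Mg Mg0 gM] := lip_bounded lg.
case: lf lg => [L L0 fL] [M M0 gL]; exists (L * Mg + Mf * M).
  by rewrite addr_ge0 ?mulr_ge0.
move=> x y d cx cy d0 xy.
have -> : f x * g x - f y * g y = (f x - f y) * g x + f y * (g x - g y) by ring.
rewrite (le_trans (ler_normD _ _)) // [(L * Mg + _) * d]mulrDl !normrM.
rewrite [L * Mg * d]mulrAC -[Mf * M * d]mulrA.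
by rewrite lerD // ler_pM ?fL ?gM ?fM ?gL.
Qed.

Lemma lipN f : lip f -> lip (fun x => - f x).
Proof.
move=> [L L0 fL]; exists L => // x y d cx cy d0 xy.
by rewrite -opprD normrN fL.
Qed.

Lemma lip_sum (J : finType) (P : pred J) (F : J -> (I -> R) -> R) :
  (forall j, lip (F j)) -> lip (fun x => \sum_(j | P j) F j x).
Proof.
move=> lF; elim: (index_enum J) => [|j s IH].
  by under eq_fun do rewrite big_nil; exact: lip_cst.
under eq_fun do rewrite big_cons.
by case: (P j) => //; exact: lipD.
Qed.

Lemma lip_prod (J : finType) (P : pred J) (F : J -> (I -> R) -> R) :
  (forall j, lip (F j)) -> lip (fun x => \prod_(j | P j) F j x).
Proof.
move=> lF; elim: (index_enum J) => [|j s IH].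
  by under eq_fun do rewrite big_nil; exact: lip_cst.
under eq_fun do rewrite big_cons.
by case: (P j) => //; exact: lipM.
Qed.

Lemma lipV f a : 0 < a -> lip f -> (forall x, in_cube x -> a <= f x) ->
  lip (fun x => (f x)^-1).
Proof.
move=> a0 [L L0 fL] fa; exists (L / (a * a)); first by rewrite divr_ge0 // mulr_ge0 ?ltW.
move=> x y d cx cy d0 xy.
have fx := lt_le_trans a0 (fa _ cx); have fy := lt_le_trans a0 (fa _ cy).
have -> : (f x)^-1 - (f y)^-1 = - (f x - f y) / (f x * f y).
  by field; rewrite !gt_eqF.
rewrite normrM normrN normfV [in X in _ / X]gtr0_norm ?mulr_gt0 //.
rewrite mulrAC ler_pM ?invr_ge0 ?mulr_ge0 ?(ltW fx) ?(ltW fy) ?fL //.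
by rewrite lef_pV2 ?posrE ?mulr_gt0 // ler_pM ?fa ?ltW.
Qed.

Lemma lip_subst f j a : 0 <= a <= 1 -> lip f -> lip (fun x => f (subst x j a)).
Proof.
move=> a01 [L L0 fL]; exists L => // x y d cx cy d0 xy.
apply: fL => //; try exact: in_cube_subst.
by move=> i; rewrite /subst; case: ifP => // _; rewrite subrr normr0.
Qed.

(** On a fine grid, label [c] records whether [g c] is negative, with the values required by [kuhn]
    imposed on two faces. In the cell found, [g c] takes both signs unless a face imposed a label;
    then [x c] is 0 or 1 and the corresponding inequality is void. *)
Lemma approx_complementarity (g : I -> (I -> R) -> R) (delta : R) : 0 < delta ->
  (forall j, lip (g j)) ->
  exists2 x, in_cube x &
    forall j, (x j < 1 -> g j x <= delta) /\ (0 < x j -> - delta <= g j x).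
Proof.
move=> d0 lg; pose L j : R := s2val (cid2 (lg j)).
have L0 j : 0 <= L j by exact: (s2valP (cid2 (lg j))).
have gL j := s2valP' (cid2 (lg j)).
rewrite -/(L _) in gL.
pose M := \sum_j L j; have LM j : L j <= M.
  by rewrite /M (bigD1 j) //= lerDl sumr_ge0.
have M0 : 0 <= M by rewrite sumr_ge0.
(* Mesh 1/p moves each [g j] by at most [delta] within a cell; [.+2] makes [p.-1] nonzero, so that
   [b i = 0] gives [x i = 0]. *)
pose p := (Num.bound (M / delta)).+2.
have p0 : 0 < p%:R :> R by rewrite ltr0n.
have Mp : M / p%:R <= delta.
  rewrite ler_pdivrMr // mulrC -ler_pdivrMr //.
  have /ltW/le_trans := archi_boundP (divr_ge0 M0 (ltW d0)); apply.
  by rewrite ler_nat /p -addn2 leq_addr.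
pose pt (v : {ffun I -> nat}) i : R := (v i)%:R / p%:R.
pose l c (v : {ffun I -> nat}) := (v c != 0%N) && ((v c == p) || (g c (pt v) < 0)).
have [|c v E|b bp H] := @kuhn I p l; first by move=> c v E; rewrite /l E eqxx.
  by rewrite /l E eqxx.
(* The lower end of the cell in each coordinate, except that a cell touching the upper face is
   represented by 1. *)
pose x i : R := if b i == p.-1 then 1 else (b i)%:R / p%:R.
have cpt (v : {ffun I -> nat}) : (forall i, (v i <= p)%N) -> in_cube (pt v).
  by move=> vp i; rewrite /pt divr_ge0 ?ler0n //= ler_pdivrMr // mul1r ler_nat.
have cx : in_cube x.
  move=> i; rewrite /x; case: ifP => _; first by rewrite lexx ler01.
  by rewrite divr_ge0 ?ler0n //= ler_pdivrMr // mul1r ler_nat ltnW.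
have near j (w : {ffun I -> nat}) : (forall i, (b i <= w i <= (b i).+1)%N) ->
    `|g j x - g j (pt w)| <= delta.
  move=> bw; apply: (le_trans _ Mp); apply: (@le_trans _ _ (L j / p%:R)); last first.
    by rewrite ler_pM2r ?invr_gt0.
  apply: gL; [exact: cx| |by rewrite invr_ge0 ltW|].
  - apply: cpt => i; have /andP[_ h] := bw i; exact: (leq_trans h (bp i)).
  - move=> i; have -> : x i = (if b i == p.-1 then p else b i)%:R / p%:R.
      by rewrite /x; case: ifP => // _; rewrite divff // gt_eqF.
    rewrite /pt -mulrBl normrM [X in _ * X]ger0_norm ?invr_ge0 ?(ltW p0) //.
    rewrite ler_piMl ?invr_ge0 ?(ltW p0) //.
    have /andP[b1 b2] := bw i.
    case: ifP => [/eqP bi|_].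
      have [wi|wi] : w i = p.-1 \/ w i = p.
        by rewrite bi in b1 b2; move: b2; rewrite leq_eqVlt => /predU1P[->|]; [right|rewrite ltnS => b2; left; apply/eqP; rewrite eqn_leq b2].
      by rewrite wi /= -[X in X%:R - _]addn1 natrD addrAC subrr add0r normr1.
      by rewrite wi subrr normr0 ler01.
    move: b2; rewrite leq_eqVlt => /predU1P[->|].
      by rewrite -addn1 natrD opprD addNKr normrN1.
    rewrite ltnS => b2; have -> : w i = b i by apply/eqP; rewrite eqn_leq b2.
    by rewrite subrr normr0 ler01.
exists x => // j; have [w [w' [lw lw' bw bw']]] := H j.
split=> [xj1|xj0].
- have bj : b j != p.-1 by apply: contraTneq xj1 => E; rewrite /x E eqxx ltxx.
  move: lw'; rewrite /l => /andP[_ /orP[/eqP w'p|gw]].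
    have /andP[_] := bw' j; rewrite w'p => h.
    by move: bj; rewrite -(eqn_add2r 1) !addn1 /= eqn_leq bp h.
  have := near j w' bw'; rewrite ler_norml => /andP[_]; lra.
- have bj : (0 < b j)%N.
    rewrite lt0n; apply: contraTneq xj0 => E; rewrite /x E /= mul0r ltxx //.
  have /andP[h _] := bw j.
  move: lw; rewrite /l -lt0n (leq_trans bj h) /= => /negbT.
  rewrite negb_or -leNgt => /andP[_ gw].
  have := near j w bw; rewrite ler_norml => /andP[+ _]; lra.
Qed.

End Lipschitz.

(** * Payoff of one stage and stationary equilibria of the auxiliary game *)

Section Stage.
Variables (R : realType) (N : nat) (r : {set 'I_N} -> 'I_N -> R).
Implicit Types (x : 'I_N -> R) (S : {set 'I_N}) (i j : 'I_N) (c : R).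

Definition pquit x S : R := (\prod_(i in S) x i) * \prod_(i in ~: S) (1 - x i).

Definition stage x c j : R :=
  \sum_(S : {set 'I_N} | S != finset.set0) pquit x S * r S j + pquit x finset.set0 * c.

Lemma pquitE x S : pquit x S = \prod_i (if i \in S then x i else 1 - x i).
Proof.
rewrite (bigID (mem S)) /=; congr (_ * _).
  by apply: eq_bigr => i ->.
by apply: eq_big => [i|i]; rewrite inE // => /negbTE ->.
Qed.

Lemma pquit0 x : pquit x finset.set0 = \prod_i (1 - x i).
Proof. by rewrite pquitE; apply: eq_bigr => i _; rewrite inE. Qed.

Lemma sum_pquit x : \sum_S pquit x S = 1.
Proof.
under eq_bigr do rewrite pquitE.
rewrite (_ : \sum_(i : {set 'I_N}) _ = \prod_i (x i + (1 - x i))).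
  by rewrite big1 // => i _; rewrite addrC subrK.
by rewrite (bigA_distr 1 +%R); apply: eq_bigl => S; rewrite inE.
Qed.

Lemma pquit_ge0 x S : in_cube x -> 0 <= pquit x S.
Proof.
move=> cx; rewrite pquitE; apply: prodr_ge0 => i _.
by have /andP[? ?] := cx i; case: ifP; rewrite ?subr_ge0.
Qed.

Lemma pquit_le1 x S : in_cube x -> pquit x S <= 1.
Proof.
move=> cx; rewrite pquitE; apply: prodr_ile1 => i _.
by have /andP[? ?] := cx i; case: ifP => _; rewrite ?subr_ge0 ?lerBlDr ?lerDl; apply/andP.
Qed.

Lemma pquit_subst x j y S : pquit (subst x j y) S =
  (if j \in S then y else 1 - y) *
  \prod_(i | i != j) (if i \in S then x i else 1 - x i).
Proof.
rewrite pquitE (bigD1 j) //= /subst eqxx; congr (_ * _).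
by apply: eq_bigr => i /negbTE ->.
Qed.

Lemma pquit_affine x j y S : pquit (subst x j y) S =
  y * pquit (subst x j 1) S + (1 - y) * pquit (subst x j 0) S.
Proof. by rewrite !pquit_subst; case: ifP => _; ring. Qed.

Lemma stage_affine x j y c k : stage (subst x j y) c k =
  y * stage (subst x j 1) c k + (1 - y) * stage (subst x j 0) c k.
Proof.
rewrite /stage pquit_affine !mulrDr addrACA !mulr_sumr -big_split /=.
congr (_ + _); last by ring.
by apply: eq_bigr => S _; rewrite pquit_affine; ring.
Qed.

Lemma subst_id x j : subst x j (x j) = x.
Proof. by apply/funext => i; rewrite /subst; case: eqP => // ->. Qed.

Lemma substK x j a b : subst (subst x j a) j b = subst x j b.
Proof. by apply/funext => i; rewrite /subst; case: eqP. Qed.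

Lemma stageD x c d j : stage x (c + d) j = stage x c j + pquit x finset.set0 * d.
Proof. by rewrite /stage mulrDr addrA. Qed.

Lemma stage_quit x j c d k : stage (subst x j 1) c k = stage (subst x j 1) d k.
Proof. by rewrite /stage pquit_subst inE subrr !mul0r. Qed.

Lemma stage_homo x c d j : in_cube x -> c <= d -> stage x c j <= stage x d j.
Proof. by move=> cx cd; rewrite /stage lerD2l ler_wpM2l // pquit_ge0. Qed.

Lemma stage_bound x c j (M : R) : in_cube x -> (forall S, `|r S j| <= M) -> `|c| <= M ->
  `|stage x c j| <= M.
Proof.
move=> cx rM cM; rewrite (le_trans (ler_normD _ _)) //.
have -> : M = \sum_(S : {set 'I_N} | S != finset.set0) pquit x S * M
    + pquit x finset.set0 * M.
  have := sum_pquit x; rewrite (bigD1 finset.set0) //= addrC => E.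
  by rewrite -mulr_suml -mulrDl E mul1r.
rewrite lerD //; last by rewrite normrM ger0_norm ?pquit_ge0 // ler_wpM2l // pquit_ge0.
rewrite (le_trans (ler_norm_sum _ _ _)) // ler_sum // => S _.
by rewrite normrM ger0_norm ?pquit_ge0 // ler_wpM2l // pquit_ge0.
Qed.

Hypothesis r_bound : forall S j, `|r S j| <= 2.
Hypothesis r_single : forall j, r (finset.set1 j) j = 0.

Lemma sum_pquit_bound x (P : pred {set 'I_N}) j : in_cube x ->
  `|\sum_(S | P S) pquit x S * r S j| <= (\sum_(S | P S) pquit x S) * 2.
Proof.
move=> cx; rewrite (le_trans (ler_norm_sum _ _ _)) // mulr_suml ler_sum // => S _.
by rewrite normrM ger0_norm ?pquit_ge0 // ler_wpM2l // pquit_ge0.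
Qed.

Lemma pquit0_subst x j a : pquit (subst x j a) finset.set0 =
  (1 - a) * \prod_(i | i != j) (1 - x i).
Proof.
by rewrite pquit_subst inE; congr (_ * _); apply: eq_bigr => i _; rewrite inE.
Qed.

Lemma pquit0_subst0_ge x j : in_cube x ->
  pquit x finset.set0 <= pquit (subst x j 0) finset.set0.
Proof.
move=> cx; rewrite -{1}(subst_id x j) !pquit0_subst subr0 ler_wpM2r //.
  by apply: prodr_ge0 => i _; have /andP[? ?] := cx i; rewrite subr_ge0.
by have /andP[? ?] := cx j; rewrite lerBlDr lerDl.
Qed.

(** Quitting alone pays 0, so only joint quitting counts, and another player quits with probability
    at most [1 - pquit x finset.set0]. *)
Lemma stage_quit_small x c j : in_cube x ->
  `|stage (subst x j 1) c j| <= 2 * (1 - pquit x finset.set0).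
Proof.
move=> cx; have cx1 : in_cube (subst x j 1).
  by apply: in_cube_subst => //; rewrite ler01 lexx.
rewrite (stage_quit x j c 0) /stage mulr0 addr0.
rewrite (bigD1 (finset.set1 j)) /=; last first.
  by apply/set0Pn; exists j; rewrite inE.
rewrite r_single mulr0 add0r (le_trans (sum_pquit_bound _ _ _)) // mulrC ler_wpM2l //.
rewrite lerBrDr -[leRHS](sum_pquit (subst x j 1)) [leRHS](bigD1 (finset.set1 j)) //= [leLHS]addrC lerD //.
  rewrite (le_trans (pquit0_subst0_ge j cx)) // pquit0_subst pquit_subst.
  rewrite subr0 !inE eqxx; apply: ler_wpM2l => //; apply: ler_prod => i ij.
  rewrite inE (negbTE ij) lexx andbT.
  by have /andP[? ?] := cx i; rewrite subr_ge0.
rewrite big_mkcond [leRHS]big_mkcond /=; apply: ler_sum => S _.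
by case: (S != finset.set1 j); rewrite ?andbF // andbT; case: ifP => // _; rewrite pquit_ge0.
Qed.

Lemma stage_continue_small x c j : in_cube x ->
  `|stage (subst x j 0) c j - pquit (subst x j 0) finset.set0 * c|
    <= 2 * (1 - pquit x finset.set0).
Proof.
move=> cx; have cx0 : in_cube (subst x j 0).
  by apply: in_cube_subst => //; rewrite ler01 lexx.
rewrite /stage addrK (le_trans (sum_pquit_bound _ _ _)) // mulrC ler_wpM2l //.
apply: (@le_trans _ _ (1 - pquit (subst x j 0) finset.set0)).
  by rewrite lerBrDr -[leRHS](sum_pquit (subst x j 0)) [leRHS](bigD1 finset.set0) //= [leLHS]addrC.
by rewrite lerD2l lerN2 pquit0_subst0_ge.
Qed.

Lemma lip_pquit S : lip (fun x => pquit x S).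
Proof.
apply: lipM; apply: lip_prod => i; first exact: lip_proj.
by apply: lipD; [exact: lip_cst | apply: lipN; exact: lip_proj].
Qed.

Lemma lip_stage (f : ('I_N -> R) -> R) j : lip f -> lip (fun x => stage x (f x) j).
Proof.
move=> lf; apply: lipD; last exact: lipM (lip_pquit _) lf.
by apply: lip_sum => S; apply: lipM; [exact: lip_pquit|exact: lip_cst].
Qed.

(* An approximate stationary equilibrium of the auxiliary game in which, before
   every stage, play stops with probability lam and then pays q. *)
Lemma stationary_equilibrium (q : 'I_N -> R) (lam delta : R) :
  0 < lam < 1 -> 0 < delta ->
  exists x (V : 'I_N -> R), [/\ in_cube x,
    forall j, V j = lam * q j + (1 - lam) * stage x (V j) j &
    forall j, (x j < 1 -> stage (subst x j 1) 0 j <= stage (subst x j 0) (V j) j + delta) /\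
      (0 < x j -> stage (subst x j 0) (V j) j <= stage (subst x j 1) 0 j + delta)].
Proof.
move=> /andP[l0 l1] d0.
(* Since [stage] is affine in the continuation, the equation for [V j] is linear with coefficient
   [den x]; [lam <= den x] makes its solution Lipschitz in [x]. *)
pose den x := 1 - (1 - lam) * pquit x finset.set0.
have denP x : in_cube x -> lam <= den x.
  by move=> cx; have := pquit_le1 finset.set0 cx; rewrite /den; nra.
pose V x j := (lam * q j + (1 - lam) * stage x 0 j) / den x.
have lV j : lip (fun x => V x j).
  apply: lipM.
    apply: lipD; first exact: lip_cst.
    by apply: lipM; [exact: lip_cst|apply: (@lip_stage (fun=> 0)); exact: lip_cst].
  apply: (lipV l0 _ denP); apply: lipD; first exact: lip_cst.
  by apply: lipN; apply: lipM; [exact: lip_cst | exact: lip_pquit].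
(* The gain of quitting over continuing: approximate complementarity for [g] is the equilibrium
   condition. *)
pose g j x := stage (subst x j 1) 0 j - stage (subst x j 0) (V x j) j.
have lg j : lip (g j).
  have b1 : 0 <= (1 : R) <= 1 by rewrite lexx ler01.
  have b0 : 0 <= (0 : R) <= 1 by rewrite lexx ler01.
  apply: lipD.
    by apply: (@lip_subst _ _ (fun x => stage x 0 j)) => //; apply: (@lip_stage (fun=> 0)); exact: lip_cst.
  apply: lipN; apply: lipD.
    apply: (@lip_subst _ _ (fun x => \sum_(S | S != finset.set0) pquit x S * r S j)) => //.
    by apply: lip_sum => S; apply: lipM; [exact: lip_pquit|exact: lip_cst].
  apply: lipM => //.
  by apply: (@lip_subst _ _ (fun x => pquit x finset.set0)) => //; exact: lip_pquit.
have [x cx xP] := approx_complementarity d0 lg.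
exists x, (V x); split=> // j.
- have dx := lt_le_trans l0 (denP x cx).
  apply: (mulIf (lt0r_neq0 dx)); set z := V x j.
  have zE : z * den x = lam * q j + (1 - lam) * stage x 0 j.
    by rewrite /z /V divfK ?lt0r_neq0.
  rewrite -[in stage x z j](add0r z) stageD.
  have -> : (lam * q j + (1 - lam) * (stage x 0 j + pquit x finset.set0 * z)) * den x =
    (lam * q j + (1 - lam) * stage x 0 j) * den x +
    (1 - lam) * pquit x finset.set0 * (z * den x) by ring.
  by rewrite zE /den; ring.
- have [h1 h2] := xP j; split=> [/h1|/h2]; rewrite /g; lra.
Qed.

End Stage.

Local Open Scope classical_set_scope.
Local Open Scope ring_scope.

(** * Means over one uniform signal *)

Section UnitIntegral.
Variable R : realType.
Implicit Types (f g : R -> R).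

Definition unit_mean f : R := Rintegral (@lebesgue_measure R) `[0, 1] f.

Definition bounded_measurable f :=
  measurable_fun [set: R] f /\ exists M : R, forall x, `|f x| <= M.

Lemma lebesgue_unit : (@lebesgue_measure R) `[0, 1] = 1%E.
Proof. by rewrite lebesgue_measure_itv /= lte_fin ltr01 -EFinB subr0. Qed.

Lemma bounded_measurable_integrable f : bounded_measurable f ->
  (@lebesgue_measure R).-integrable `[0, 1] (EFin \o f).
Proof.
move=> [mf [M fM]]; apply: measurable_bounded_integrable => //.
- by rewrite [X in (X < _)%E]lebesgue_unit ltry.
- exact: measurable_funS mf.
- by exists M; split; [exact: num_real|move=> y My x _; exact: le_trans (fM x) (ltW My)].
Qed.

Lemma bounded_measurable_cst c : bounded_measurable (fun=> c).
Proof. by split; [exact: measurable_cst | exists `|c|]. Qed.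

Lemma bounded_measurableD f g : bounded_measurable f -> bounded_measurable g ->
  bounded_measurable (fun x => f x + g x).
Proof.
move=> [mf [M fM]] [mg [K gK]]; split; first exact: measurable_funD.
by exists (M + K) => x; rewrite (le_trans (ler_normD _ _)) // lerD.
Qed.

Lemma bounded_measurableM f g : bounded_measurable f -> bounded_measurable g ->
  bounded_measurable (fun x => f x * g x).
Proof.
move=> [mf [M fM]] [mg [K gK]]; split; first exact: measurable_funM.
by exists (M * K) => x; rewrite normrM ler_pM.
Qed.

Lemma bounded_measurable_sum (J : Type) (s : seq J) (P : pred J) (F : J -> R -> R) :
  (forall j, bounded_measurable (F j)) ->
  bounded_measurable (fun x => \sum_(j <- s | P j) F j x).
Proof.
move=> bF; elim: s => [|j s IH].
  by under eq_fun do rewrite big_nil; exact: bounded_measurable_cst.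
under eq_fun do rewrite big_cons.
by case: (P j) => //; exact: bounded_measurableD.
Qed.

Lemma unit_mean_cst c : unit_mean (fun=> c) = c.
Proof. by rewrite /unit_mean Rintegral_cst //= [X in fine X]lebesgue_unit /= mulr1. Qed.

Lemma unit_meanD f g : bounded_measurable f -> bounded_measurable g ->
  unit_mean (fun x => f x + g x) = unit_mean f + unit_mean g.
Proof. by move=> bf bg; apply: RintegralD => //; exact: bounded_measurable_integrable. Qed.

Lemma unit_meanZ c f : bounded_measurable f ->
  unit_mean (fun x => c * f x) = c * unit_mean f.
Proof. by move=> bf; apply: RintegralZl => //; exact: bounded_measurable_integrable. Qed.

Lemma unit_mean_sum (J : Type) (s : seq J) (P : pred J) (F : J -> R -> R) :
  (forall j, bounded_measurable (F j)) ->
  unit_mean (fun x => \sum_(j <- s | P j) F j x) = \sum_(j <- s | P j) unit_mean (F j).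
Proof.
move=> bF; elim: s => [|j s IH].
  by rewrite big_nil; under [X in unit_mean X]eq_fun do rewrite big_nil; exact: unit_mean_cst.
rewrite big_cons; under [X in unit_mean X]eq_fun do rewrite big_cons.
by case: (P j) => //; rewrite unit_meanD ?IH //; exact: bounded_measurable_sum.
Qed.

Lemma le_unit_mean f g : bounded_measurable f -> bounded_measurable g ->
  (forall x, f x <= g x) -> unit_mean f <= unit_mean g.
Proof.
by move=> bf bg fg; apply: le_Rintegral => //; exact: bounded_measurable_integrable.
Qed.

Lemma unit_mean_step (lam a b : R) : 0 <= lam <= 1 ->
  bounded_measurable (fun x => if x < lam then a else b) /\
  unit_mean (fun x => if x < lam then a else b) = lam * a + (1 - lam) * b.
Proof.
move=> /andP[l0 l1].
have bI : bounded_measurable (\1_(`[0, lam[) : R -> R).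
  split; first exact: measurable_indic.
  by exists 1 => x; rewrite indicE; case: (_ \in _); rewrite ?normr1 ?normr0 ?ler01.
have iE : unit_mean (\1_(`[0, lam[)) = lam.
  rewrite /unit_mean /Rintegral integral_indic //=.
  rewrite (_ : _ `&` _ = `[0, lam[%classic); last first.
    apply/seteqP; split=> x /=; rewrite !in_itv /=; first by case.
    move=> /andP[x0 xl]; split; first by rewrite x0.
    by rewrite x0 (le_trans (ltW xl)).
  rewrite lebesgue_measure_itv /= lte_fin.
  by case: ltrP => [_|l0']; rewrite -?EFinB ?subr0 //=; apply/eqP; rewrite eq_le l0 l0'.
have bs : bounded_measurable (fun x : R => if x < lam then a else b).
  split.
    by apply: measurable_fun_ifT => //; exact: measurable_fun_ltr.
  exists (`|a| + `|b|) => x; case: ifP => _; first by rewrite lerDl.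
  by rewrite lerDr.
split=> //; rewrite (_ : unit_mean _ = unit_mean (fun x => (a - b) * \1_(`[0, lam[) x + b)).
  rewrite unit_meanD ?unit_meanZ ?iE ?unit_mean_cst //; first by ring.
    by apply: bounded_measurableM => //; exact: bounded_measurable_cst.
  exact: bounded_measurable_cst.
apply: eq_Rintegral => x /[!inE] /=; rewrite in_itv /= => /andP[x0 _].
rewrite indicE; have -> : (x \in `[0, lam[%classic) = (x < lam).
  by apply/idP/idP; rewrite inE /= in_itv /= x0.
by case: ifP => _; rewrite ?mulr1 ?mulr0 ?subrK ?add0r.
Qed.

(** Tonelli for [H] cut off by the indicator of [0,1]; this keeps expectations over later signals
    measurable in the earlier ones. *)
Lemma measurable_unit_mean d (T : measurableType d) (H : T * R -> R) :
  measurable_fun [set: T * R] H -> (forall z, 0 <= H z <= 1) ->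
  measurable_fun [set: T] (fun p => unit_mean (fun x => H (p, x))).
Proof.
move=> mH H01.
pose f (z : T * R) : \bar R := (H z * \1_(`[0, 1]) z.2)%:E.
have mf : measurable_fun [set: T * R] f.
  apply/measurable_EFinP; apply: measurable_funM => //.
  have m1 : measurable_fun [set: R] (\1_(`[0, 1]) : R -> R) by exact: measurable_indic.
  exact: measurableT_comp m1 measurable_snd.
have f0 z : (0 <= f z)%E.
  by rewrite lee_fin mulr_ge0 //; have /andP[] := H01 z.
have := @measurable_fun_fubini_tonelli_F _ _ _ _ _ (@lebesgue_measure R) f mf f0.
move=> /(measurableT_comp (@fine_measurable R setT measurableT)).
rewrite (_ : fine \o _ = (fun p => unit_mean (fun x => H (p, x)))) //.
apply/funext => p; rewrite /= /fubini_F /unit_mean /Rintegral; congr fine.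
rewrite [RHS]integral_mkcond; apply: eq_integral => x _.
rewrite /f /= patchE indicE; case: ifP => _; first by rewrite mulr1.
by rewrite mulr0.
Qed.

End UnitIntegral.

(** * Conditioning on the first signal, and convergence of the payoffs *)

Section Recursion.
Variables (R : realType) (N : nat).
Implicit Types (xi : profile R N) (S : {set 'I_N}) (i j : 'I_N) (t n : nat) (a c : R).

Definition first_quit xi a : 'I_N -> R := fun i => xi i 0%N [tuple a].

Definition shift_strat a (x : strat R) : strat R := fun t h => x t.+1 [tuple of a :: h].

Definition shift a xi : profile R N := fun i => shift_strat a (xi i).

Lemma hist_scons0 (s : nat -> R) a : hist (scons a s) 0 = [tuple a].
Proof. by apply: eq_from_tnth => i; rewrite tnth_mktuple !(tnth_nth 0) (ord1 i). Qed.

Lemma hist_sconsS (s : nat -> R) a t : hist (scons a s) t.+1 = [tuple of a :: hist s t].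
Proof.
apply: eq_from_tnth => i; rewrite tnth_mktuple.
case: (unliftP ord0 i) => [k ->|->]; last by rewrite tnth0.
by rewrite tnthS tnth_mktuple.
Qed.

Lemma stopS_scons0 xi S a s : stopS xi 0 S (scons a s) = pquit (first_quit xi a) S.
Proof.
rewrite /stopS /survive big_ord0 mul1r /pquit /qprob /first_quit.
by congr (_ * _); apply: eq_bigr => i _; rewrite hist_scons0.
Qed.

Lemma stopS_sconsS xi t S a s : stopS xi t.+1 S (scons a s) =
  pquit (first_quit xi a) finset.set0 * stopS (shift a xi) t S s.
Proof.
have E i u : qprob xi i u.+1 (scons a s) = qprob (shift a xi) i u s.
  by rewrite /qprob /shift /shift_strat -hist_sconsS.
rewrite pquit0 /stopS /survive big_ord_recl -!mulrA; congr (_ * (_ * (_ * _))).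
- by apply: eq_bigr => i _; rewrite /qprob hist_scons0.
- by apply: eq_bigr => u _; apply: eq_bigr => i _; rewrite -E.
- by apply: eq_bigr => i _; rewrite E.
- by apply: eq_bigr => i _; rewrite E.
Qed.

(** The parameter in [T] stands for signals already observed. *)
Definition measurable_family d (T : measurableType d) (xi : T -> profile R N) :=
  forall i t,
    measurable_fun [set: T * t.+1.-tuple R] (fun z => xi z.1 i t z.2) /\
    forall p h, 0 <= xi p i t h <= 1.

Lemma measurable_family_cst d (T : measurableType d) xi : valid_profile xi ->
  measurable_family (fun _ : T => xi).
Proof.
move=> vxi i t; have [m b] := vxi i t; split=> //.
exact: (measurableT_comp m measurable_snd).
Qed.

Lemma measurable_family_shift d (T : measurableType d) (xi : T -> profile R N) :
  measurable_family xi ->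
  measurable_family (fun z : T * R => shift z.2 (xi z.1)).
Proof.
move=> mxi i t; have [m b] := mxi i t.+1; split=> // [|p h]; last exact: b.
rewrite /shift /shift_strat.
have mp : measurable_fun [set: (T * R) * t.+1.-tuple R]
    (fun z => (z.1.1, [tuple of z.1.2 :: z.2])).
  apply: measurable_fun_pair.
    exact: (measurableT_comp measurable_fst measurable_fst).
  apply: measurable_cons => //.
  exact: (measurableT_comp measurable_snd measurable_fst).
exact: (measurableT_comp m mp).
Qed.

Lemma measurable_family_pquit d (T : measurableType d) (xi : T -> profile R N) S :
  measurable_family xi ->
  measurable_fun [set: T * R] (fun z => pquit (first_quit (xi z.1) z.2) S).
Proof.
move=> mxi.
have mq i : measurable_fun [set: T * R] (fun z => first_quit (xi z.1) z.2 i).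
  have [m _] := mxi i 0%N.
  have mp : measurable_fun [set: T * R] (fun z => (z.1, [tuple z.2])).
    apply: measurable_fun_pair => //.
    apply/measurable_fun_tnthP => k.
    rewrite (_ : _ \o _ = snd) //; apply/funext => z /=.
    by rewrite (tnth_nth 0) (ord1 k).
  exact: (measurableT_comp m mp).
rewrite /pquit; apply: measurable_funM.
  under eq_fun do rewrite big_mkcond.
  by apply: measurable_prod => i _; case: (i \in S) => //; exact: measurable_cst.
under eq_fun do rewrite big_mkcond.
apply: measurable_prod => i _; case: (i \in ~: S); last exact: measurable_cst.
by apply: measurable_funB => //; exact: measurable_cst.
Qed.

(** Proved together and for every parameter space: conditioning on a signal replaces [T] by [T * R],
    and constants leave [Esig] once the integrands are known to be measurable and bounded. *)
Lemma pstop_family t : forall d (T : measurableType d) (xi : T -> profile R N) S,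
  measurable_family xi ->
  [/\ measurable_fun [set: T] (fun p => pstop (xi p) t S),
      forall p, 0 <= pstop (xi p) t S <= 1,
      forall p c, Esig t.+1 (fun s => c * stopS (xi p) t S s) = c * pstop (xi p) t S &
      forall p, pstop (xi p) t S = if t is t'.+1
        then unit_mean (fun x => pquit (first_quit (xi p) x) finset.set0 *
          pstop (shift x (xi p)) t' S)
        else unit_mean (fun x => pquit (first_quit (xi p) x) S)].
Proof.
have mean01 (f : R -> R) : measurable_fun [set: R] f -> (forall x, 0 <= f x <= 1) ->
    bounded_measurable f /\ 0 <= unit_mean f <= 1.
  move=> mf f01; have bf : bounded_measurable f.
    by split=> //; exists 1 => x; have /andP[? ?] := f01 x; rewrite ger0_norm.
  split=> //; rewrite -{1}(unit_mean_cst (0 : R)) -{1}(unit_mean_cst (1 : R)).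
  by rewrite !le_unit_mean //; try exact: bounded_measurable_cst;
    move=> x; have /andP[] := f01 x.
elim: t => [|t IH] d T xi S mxi.
  have mp := measurable_family_pquit S mxi.
  have q01 z : 0 <= pquit (first_quit (xi z.1) z.2) S <= 1.
    have cz : in_cube (first_quit (xi z.1) z.2) by move=> i; have [_] := mxi i 0%N; apply.
    by rewrite pquit_ge0 // pquit_le1.
  have E p : pstop (xi p) 0 S = unit_mean (fun x => pquit (first_quit (xi p) x) S).
    by apply: eq_Rintegral => x _; rewrite /= stopS_scons0.
  have bm p : bounded_measurable (fun x => pquit (first_quit (xi p) x) S) /\
      0 <= unit_mean (fun x => pquit (first_quit (xi p) x) S) <= 1.
    apply: mean01 => [|x]; last exact: (q01 (p, x)).
    exact: (measurable_fun_pair2 p mp).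
  split=> //.
  - under eq_fun do rewrite E.
    exact: (measurable_unit_mean mp q01).
  - by move=> p; rewrite E; case: (bm p).
  - move=> p c; rewrite E -unit_meanZ; last by case: (bm p).
    by apply: eq_Rintegral => x _; rewrite /= stopS_scons0.
have mxi' := measurable_family_shift mxi.
have [mst st01 EZ _] := IH _ _ _ S mxi'.
pose H (z : T * R) := pquit (first_quit (xi z.1) z.2) finset.set0 * pstop (shift z.2 (xi z.1)) t S.
have mH : measurable_fun [set: T * R] H.
  by apply: measurable_funM => //; exact: measurable_family_pquit.
have H01 z : 0 <= H z <= 1.
  have cz : in_cube (first_quit (xi z.1) z.2) by move=> i; have [_] := mxi i 0%N; apply.
  have /andP[s0 s1] := st01 z.
  by rewrite /H mulr_ge0 ?pquit_ge0 //= mulr_ile1 ?pquit_ge0 ?pquit_le1.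
have bm p : bounded_measurable (fun x => H (p, x)) /\
    0 <= unit_mean (fun x => H (p, x)) <= 1.
  apply: mean01 => [|x]; last exact: H01.
  exact: (measurable_fun_pair2 p mH).
have EE p c : Esig t.+2 (fun s => c * stopS (xi p) t.+1 S s) =
    unit_mean (fun x => c * H (p, x)).
  change (unit_mean (fun x => Esig t.+1 (fun s => c * stopS (xi p) t.+1 S (scons x s)))
    = unit_mean (fun x => c * H (p, x))).
  congr unit_mean; apply/funext => x; rewrite /H mulrA -(EZ (p, x)).
  by congr (Esig t.+1 _); apply/funext => s; rewrite stopS_sconsS mulrA.
have E p : pstop (xi p) t.+1 S = unit_mean (fun x => H (p, x)).
  transitivity (Esig t.+2 (fun s => 1 * stopS (xi p) t.+1 S s)).
    by congr (Esig t.+2 _); apply/funext => s; rewrite mul1r.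
  by rewrite EE; congr unit_mean; apply/funext => x; rewrite mul1r.
split=> //.
- under eq_fun do rewrite E.
  exact: measurable_unit_mean mH H01.
- by move=> p; rewrite E; case: (bm p).
- by move=> p c; rewrite EE E unit_meanZ //; case: (bm p).
Qed.

Section ValidProfile.
Variable xi : profile R N.
Hypothesis vxi : valid_profile xi.

Lemma in_cube_first_quit a : in_cube (first_quit xi a).
Proof. by move=> i; have [_] := vxi i 0%N; apply. Qed.

Lemma valid_shift a : valid_profile (shift a xi).
Proof.
move=> i t; have [m b] := vxi i t.+1; split=> [|h]; last exact: b.
have mp : measurable_fun [set: t.+1.-tuple R] (fun h => [tuple of a :: h]).
  by apply: measurable_cons => //; exact: measurable_cst.
exact: (measurableT_comp m mp).
Qed.

Lemma pstop_ge0 t S : 0 <= pstop xi t S.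
Proof.
have [_ /(_ 0)/andP[+ _] _ _] := @pstop_family t _ _ _ S (@measurable_family_cst _ R _ vxi).
by [].
Qed.

Lemma pstop0 S : pstop xi 0 S = unit_mean (fun x => pquit (first_quit xi x) S).
Proof.
by have [_ _ _ /(_ 0)] := @pstop_family 0 _ _ _ S (@measurable_family_cst _ R _ vxi).
Qed.

Lemma pstopS t S : pstop xi t.+1 S =
  unit_mean (fun x => pquit (first_quit xi x) finset.set0 * pstop (shift x xi) t S).
Proof.
by have [_ _ _ /(_ 0)] := @pstop_family t.+1 _ _ _ S (@measurable_family_cst _ R _ vxi).
Qed.

Lemma bounded_measurable_pquit S : bounded_measurable (fun x => pquit (first_quit xi x) S).
Proof.
have m := measurable_family_pquit S (@measurable_family_cst _ R _ vxi).
split; first exact: (measurable_fun_pair2 (0 : R) m).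
exists 1 => x; rewrite ger0_norm ?pquit_ge0 ?pquit_le1 //; exact: in_cube_first_quit.
Qed.

Lemma bounded_measurable_pstop_shift t S :
  bounded_measurable (fun x => pstop (shift x xi) t S).
Proof.
have mxi := measurable_family_shift (@measurable_family_cst _ R _ vxi).
have [m b _ _] := @pstop_family t _ _ _ S mxi.
split; first exact: (measurable_fun_pair2 (0 : R) m).
by exists 1 => x; have /andP[p0 p1] := b (0, x); rewrite ger0_norm.
Qed.

End ValidProfile.

Section Payoff.
Variable r : {set 'I_N} -> 'I_N -> R.

Lemma gamma_truncE xi j n : gamma_trunc r xi j n = r finset.set0 j +
  \sum_(t < n) \sum_(S : {set 'I_N} | S != finset.set0)
    pstop xi t S * (r S j - r finset.set0 j).
Proof.
rewrite /gamma_trunc mulrBl mul1r addrCA; congr (_ + _).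
rewrite mulr_suml -sumrB; apply: eq_bigr => t _.
by rewrite mulr_suml -sumrB; apply: eq_bigr => S _; rewrite mulrBr.
Qed.

Lemma bounded_measurable_gamma_shift xi j n : valid_profile xi ->
  bounded_measurable (fun x => gamma_trunc r (shift x xi) j n).
Proof.
move=> vxi; have bp := bounded_measurable_pstop_shift vxi.
rewrite /gamma_trunc; apply: bounded_measurableD.
  apply: bounded_measurable_sum => t; apply: bounded_measurable_sum => S.
  by apply: bounded_measurableM => //; exact: bounded_measurable_cst.
apply: bounded_measurableM; last exact: bounded_measurable_cst.
apply: bounded_measurableD; first exact: bounded_measurable_cst.
under eq_fun do rewrite -mulN1r.
apply: bounded_measurableM; first exact: bounded_measurable_cst.
by apply: bounded_measurable_sum => t; exact: bounded_measurable_sum.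
Qed.

Lemma bounded_measurable_stage xi j (f : R -> R) : valid_profile xi ->
  bounded_measurable f ->
  bounded_measurable (fun x => stage r (first_quit xi x) (f x) j).
Proof.
move=> vxi bf; have bq := bounded_measurable_pquit vxi.
apply: bounded_measurableD; last exact: bounded_measurableM.
apply: bounded_measurable_sum => S; apply: bounded_measurableM => //.
exact: bounded_measurable_cst.
Qed.

Lemma gamma_trunc0 xi j : gamma_trunc r xi j 0 = r finset.set0 j.
Proof. by rewrite /gamma_trunc !big_ord0 add0r subr0 mul1r. Qed.

(** Conditioning on the first signal; the later payoff bounds rest on this recursion. *)
Lemma gamma_truncS xi j n : valid_profile xi ->
  gamma_trunc r xi j n.+1 =
  unit_mean (fun x => stage r (first_quit xi x) (gamma_trunc r (shift x xi) j n) j).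
Proof.
move=> vxi.
have bq := bounded_measurable_pquit vxi.
have bp := bounded_measurable_pstop_shift vxi.
have bc := @bounded_measurable_cst R.
pose b t S x := pquit (first_quit xi x) finset.set0 * pstop (shift x xi) t S.
have bb t S : bounded_measurable (b t S) by exact: bounded_measurableM.
pose c S : R := r S j - r finset.set0 j.
have lhs : gamma_trunc r xi j n.+1 = r finset.set0 j +
    (\sum_(S : {set 'I_N} | S != finset.set0) pstop xi 0 S * c S +
     \sum_(t < n) \sum_(S : {set 'I_N} | S != finset.set0) pstop xi t.+1 S * c S).
  by rewrite gamma_truncE big_ord_recl.
have rhs x : stage r (first_quit xi x) (gamma_trunc r (shift x xi) j n) j =
    r finset.set0 j +
    (\sum_(S : {set 'I_N} | S != finset.set0) c S * pquit (first_quit xi x) S +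
     \sum_(t < n) \sum_(S : {set 'I_N} | S != finset.set0) c S * b t S x).
  have := sum_pquit (first_quit xi x); rewrite (bigD1 finset.set0) //=.
  set p0 := pquit _ finset.set0; set Q := \sum_(S | _) _ => E.
  have -> : \sum_(S : {set 'I_N} | S != finset.set0) c S * pquit (first_quit xi x) S =
      \sum_(S : {set 'I_N} | S != finset.set0) pquit (first_quit xi x) S * r S j - Q * r finset.set0 j.
    by rewrite mulr_suml -sumrB; apply: eq_bigr => S _; rewrite /c; ring.
  have -> : \sum_(t < n) \sum_(S : {set 'I_N} | S != finset.set0) c S * b t S x =
      p0 * (gamma_trunc r (shift x xi) j n - r finset.set0 j).
    rewrite gamma_truncE addrAC subrr add0r mulr_sumr; apply: eq_bigr => t _.
    by rewrite mulr_sumr; apply: eq_bigr => S _; rewrite /b /c -/p0; ring.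
  by rewrite /stage -/p0 -[Q](addKr p0) E; ring.
rewrite lhs; under [X in unit_mean X]eq_fun do rewrite rhs.
have b1 : bounded_measurable (fun x =>
    \sum_(S : {set 'I_N} | S != finset.set0) c S * pquit (first_quit xi x) S).
  by apply: bounded_measurable_sum => S; exact: bounded_measurableM.
have b2 t : bounded_measurable (fun x =>
    \sum_(S : {set 'I_N} | S != finset.set0) c S * b t S x).
  by apply: bounded_measurable_sum => S; exact: bounded_measurableM.
have b3 : bounded_measurable (fun x => \sum_(t < n)
    \sum_(S : {set 'I_N} | S != finset.set0) c S * b t S x).
  exact: bounded_measurable_sum.
rewrite unit_meanD //; last exact: bounded_measurableD.
rewrite unit_mean_cst unit_meanD //; congr (_ + (_ + _)).
  rewrite unit_mean_sum => [|S]; last exact: bounded_measurableM.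
  by apply: eq_bigr => S _; rewrite unit_meanZ // pstop0 // mulrC.
rewrite unit_mean_sum //; apply: eq_bigr => t _.
rewrite unit_mean_sum => [|S]; last exact: bounded_measurableM.
by apply: eq_bigr => S _; rewrite unit_meanZ // pstopS // mulrC.
Qed.

Lemma gamma_trunc_bound xi j n (M : R) : valid_profile xi ->
  (forall S, `|r S j| <= M) -> `|gamma_trunc r xi j n| <= M.
Proof.
move=> + rM; elim: n xi => [|n IH] xi vxi; first by rewrite gamma_trunc0.
rewrite gamma_truncS //.
have bs := bounded_measurable_stage j vxi (bounded_measurable_gamma_shift j n vxi).
have sM x : `|stage r (first_quit xi x) (gamma_trunc r (shift x xi) j n) j| <= M.
  by apply: stage_bound => //; [exact: in_cube_first_quit|apply/IH/valid_shift].
rewrite ler_norml -[X in X <= _ <= _](unit_mean_cst (- M)) -[X in _ <= _ <= X](unit_mean_cst M).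
rewrite !le_unit_mean //; try exact: bounded_measurable_cst.
  by move=> x; have := sM x; rewrite ler_norml => /andP[].
by move=> x; have := sM x; rewrite ler_norml => /andP[].
Qed.

End Payoff.

(** With payoff 1 for nonempty sets of quitters and 0 for the empty one, the truncated payoff is the
    probability of having stopped. *)
Lemma sum_pstop_le1 xi n : valid_profile xi -> (0 < N)%N ->
  \sum_(t < n) \sum_(S : {set 'I_N} | S != finset.set0) pstop xi t S <= 1.
Proof.
move=> vxi N0; pose r (S : {set 'I_N}) (j : 'I_N) : R := (S != finset.set0)%:R.
have := @gamma_trunc_bound r xi (Ordinal N0) n 1 vxi.
rewrite /gamma_trunc /r eqxx /= mulr0 addr0 => /(_ _)/(le_trans (ler_norm _)) H.
apply: (le_trans _ (H _)); last by move=> S; case: (S != _); rewrite ?normr1 ?normr0 ?ler01.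
by apply: ler_sum => t _; apply: ler_sum => S ->; rewrite mulr1.
Qed.

(** Payoffs may be negative; adding [M] gives nondecreasing bounded sums, and the truncated payoff
    is a combination of two of them. *)
Lemma cvg_gamma_trunc (r : {set 'I_N} -> 'I_N -> R) xi j : valid_profile xi ->
  cvg (gamma_trunc r xi j @ \oo).
Proof.
move=> vxi; have N0 : (0 < N)%N by case: N j => [[]|].
have cvg0 (c : {set 'I_N} -> R) (M : R) : (forall S, 0 <= c S <= M) ->
    cvg ((fun n => \sum_(t < n) \sum_(S : {set 'I_N} | S != finset.set0) pstop xi t S * c S) @ \oo).
  move=> cM; have M0 : 0 <= M by have /andP[/le_trans] := cM finset.set0; apply.
  apply: nondecreasing_is_cvgn.
    apply/nondecreasing_seqP => n; rewrite big_ord_recr /= lerDl sumr_ge0 // => S _.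
    by rewrite mulr_ge0 ?pstop_ge0 //; have /andP[] := cM S.
  exists M => _ [n _ <-]; rewrite -[leRHS]mul1r.
  apply: (le_trans _ (ler_wpM2r M0 (sum_pstop_le1 n vxi N0))).
  rewrite mulr_suml; apply: ler_sum => t _; rewrite mulr_suml; apply: ler_sum => S _.
  by rewrite ler_wpM2l ?pstop_ge0 //; have /andP[] := cM S.
pose M : R := \sum_(S : {set 'I_N}) `|r S j|.
have rM S : `|r S j| <= M by rewrite /M (bigD1 S) //= lerDl sumr_ge0.
have M0 : 0 <= M by rewrite sumr_ge0.
have c1 := cvg0 (fun S => r S j + M) (M + M).
have c2 := cvg0 (fun=> 1) 1.
have c1' : cvg ((fun n => \sum_(t < n) \sum_(S : {set 'I_N} | S != finset.set0)
    pstop xi t S * (r S j + M)) @ \oo).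
  apply: c1 => S; have := rM S; rewrite ler_norml => /andP[h1 h2].
  by rewrite -lerBlDr sub0r h1 lerD2r.
have c2' : cvg ((fun n => \sum_(t < n) \sum_(S : {set 'I_N} | S != finset.set0)
    pstop xi t S * 1) @ \oo).
  by apply: c2 => S; rewrite ler01 lexx.
rewrite (_ : gamma_trunc r xi j = (fun n => r finset.set0 j +
  ((\sum_(t < n) \sum_(S : {set 'I_N} | S != finset.set0) pstop xi t S * (r S j + M))
   - (\sum_(t < n) \sum_(S : {set 'I_N} | S != finset.set0) pstop xi t S * 1)
     * (M + r finset.set0 j)))); last first.
  apply/funext => n; rewrite gamma_truncE; congr (_ + _).
  rewrite mulr_suml -sumrB; apply: eq_bigr => t _; rewrite mulr_suml -sumrB.
  by apply: eq_bigr => S _; ring.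
apply: is_cvgD; first exact: is_cvg_cst.
by apply: is_cvgB => //; apply: is_cvgM => //; exact: is_cvg_cst.
Qed.

End Recursion.

(** * Deviations, prepended stages and stationary phases *)

Section Profiles.
Variables (R : realType) (N : nat).
Implicit Types (xi : profile R N) (eta : strat R) (x : 'I_N -> R) (i j : 'I_N) (a : R).

Lemma valid_deviate xi j eta : valid_profile xi -> valid_strat eta ->
  valid_profile (deviate xi j eta).
Proof. by move=> vxi veta i; rewrite /deviate; case: ifP => _; [exact: veta|exact: vxi]. Qed.

Lemma valid_shift_strat a eta : valid_strat eta -> valid_strat (shift_strat a eta).
Proof.
by move=> veta; have /(_ a ord0) := @valid_shift R 1 (fun=> eta) (fun=> veta).
Qed.

Lemma shift_deviate xi j eta a :
  shift a (deviate xi j eta) = deviate (shift a xi) j (shift_strat a eta).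
Proof. by apply/funext => i; rewrite /shift /deviate; case: ifP. Qed.

Lemma first_quit_deviate xi j eta a :
  first_quit (deviate xi j eta) a = subst (first_quit xi a) j (eta 0%N [tuple a]).
Proof. by apply/funext => i; rewrite /first_quit /deviate /subst; case: ifP. Qed.

Definition idle : profile R N := fun _ _ _ => 0.

Lemma valid_idle : valid_profile idle.
Proof. by move=> i t; split=> [|h]; [exact: measurable_cst|rewrite lexx ler01]. Qed.

(** The signal of the prepended stage is ignored and then dropped, so [xi] starts on fresh
    signals. *)
Definition pcons x xi : profile R N := fun i t =>
  match t with
  | 0%N => fun _ => x i
  | t'.+1 => fun h => xi i t' [tuple of behead h]
  end.

Lemma behead_cons_tuple t a (h : t.-tuple R) : [tuple of behead [tuple of a :: h]] = h.
Proof. exact/val_inj. Qed.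

Lemma shift_pcons x xi a : shift a (pcons x xi) = xi.
Proof.
apply/funext => i; apply: functional_extensionality_dep => t; apply/funext => h.
by rewrite /shift /shift_strat /= behead_cons_tuple.
Qed.

Lemma first_quit_pcons x xi a : first_quit (pcons x xi) a = x.
Proof. by []. Qed.

Lemma valid_pcons x xi : in_cube x -> valid_profile xi -> valid_profile (pcons x xi).
Proof.
move=> cx vxi i [|t]; first by split=> [|h]; [exact: measurable_cst|exact: cx].
have [m b] := vxi i t; split=> [|h]; last exact: b.
exact: (measurableT_comp m (@measurable_behead _ _ _)).
Qed.

(* Players see the signal before they act, so nobody is asked to quit at the
   stage of the switching signal: otherwise the randomization x would be played
   knowing whether the phase ends. *)
Fixpoint phase_strat (lam y : R) eta (t : nat) : t.+1.-tuple R -> R :=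
  match t with
  | 0%N => fun h => if thead h < lam then 0 else y
  | t'.+1 => fun h => if thead h < lam then eta t' [tuple of behead h]
      else phase_strat lam y eta [tuple of behead h]
  end.

Definition phase lam x xi : profile R N := fun i t => @phase_strat lam (x i) (xi i) t.

Lemma first_quit_phase lam x xi a :
  first_quit (phase lam x xi) a = if a < lam then (fun=> 0) else x.
Proof. by apply/funext => i; rewrite /first_quit /phase /= theadE; case: ifP. Qed.

Lemma shift_phase lam x xi a :
  shift a (phase lam x xi) = if a < lam then xi else phase lam x xi.
Proof.
apply/funext => i; apply: functional_extensionality_dep => t; apply/funext => h.
by rewrite /shift /shift_strat /phase /= theadE behead_cons_tuple; case: ifP.
Qed.

Lemma valid_phase lam x xi : in_cube x -> valid_profile xi ->
  valid_profile (phase lam x xi).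
Proof.
move=> cx vxi i t; rewrite /phase.
have mh n : measurable_fun [set: n.+1.-tuple R] (fun h => thead h < lam).
  by apply: measurable_fun_ltr; [exact: measurable_tnth|exact: measurable_cst].
elim: t => [|t [m b]] /=.
  split=> [|h]; first by apply: measurable_fun_ifT; [exact: mh|exact: measurable_cst|exact: measurable_cst].
  by case: ifP => _; [rewrite lexx ler01|exact: cx].
have [mx bx] := vxi i t; split=> [|h]; last by case: ifP.
apply: measurable_fun_ifT; first exact: mh.
  exact: (measurableT_comp mx (@measurable_behead _ _ _)).
exact: (measurableT_comp m (@measurable_behead _ _ _)).
Qed.

End Profiles.

(** * Bounds on deviations and payoffs, and their change under prepending *)

Section Equilibrium.
Variables (R : realType) (N : nat) (r : {set 'I_N} -> 'I_N -> R).
Implicit Types (xi : profile R N) (eta : strat R) (x u : 'I_N -> R) (i j : 'I_N).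
Implicit Types (a c e s lam theta iota delta slack : R).

(** [n0] is chosen before the deviation: after a prepended stage the rest of a deviation depends on
    the signal, so the horizon must be uniform. *)
Definition deviation_bound xi u e := exists n0 : nat, forall n j eta, (n0 <= n)%N ->
  valid_strat eta -> gamma_trunc r (deviate xi j eta) j n <= u j + e.

Definition payoff_bound xi u s := exists n0 : nat, forall n j, (n0 <= n)%N ->
  u j - s <= gamma_trunc r xi j n.

Lemma sunspot_eq_of_bounds xi u e s eps : valid_profile xi ->
  deviation_bound xi u e -> payoff_bound xi u s -> e + s <= eps ->
  sunspot_eq r eps xi.
Proof.
move=> vxi [n1 dev] [n2 pay] es; split=> // j eta veta.
have d : gamma r (deviate xi j eta) j <= u j + e.
  apply: limr_le; first exact/cvg_gamma_trunc/valid_deviate.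
  by exists n1 => // n /= ?; apply: dev.
have p : u j - s <= gamma r xi j.
  apply: limr_ge; first exact: cvg_gamma_trunc.
  by exists n2 => // n /= ?; apply: pay.
move: d p es; set g := gamma r (deviate _ _ _) _; set h := gamma r xi j => d p es.
lra.
Qed.

Lemma deviation_boundW xi u e e' : e <= e' -> deviation_bound xi u e ->
  deviation_bound xi u e'.
Proof.
move=> ee [n0 dev]; exists n0 => n j eta nn veta.
by rewrite (le_trans (dev _ _ _ nn veta)) // lerD2l.
Qed.

Lemma payoff_boundW xi u s s' : s <= s' -> payoff_bound xi u s -> payoff_bound xi u s'.
Proof.
move=> ss [n0 pay]; exists n0 => n j nn.
by rewrite (le_trans _ (pay _ _ nn)) // lerD2l lerN2.
Qed.

Lemma gamma_truncS_le xi j n lam c d : valid_profile xi -> 0 <= lam <= 1 ->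
  (forall a, stage r (first_quit xi a) (gamma_trunc r (shift a xi) j n) j <=
     if a < lam then c else d) ->
  gamma_trunc r xi j n.+1 <= lam * c + (1 - lam) * d.
Proof.
move=> vxi l01 H; have [bs <-] := unit_mean_step c d l01.
rewrite gamma_truncS // le_unit_mean //.
exact/bounded_measurable_stage/bounded_measurable_gamma_shift.
Qed.

Lemma gamma_truncS_ge xi j n lam c d : valid_profile xi -> 0 <= lam <= 1 ->
  (forall a, (if a < lam then c else d) <=
     stage r (first_quit xi a) (gamma_trunc r (shift a xi) j n) j) ->
  lam * c + (1 - lam) * d <= gamma_trunc r xi j n.+1.
Proof.
move=> vxi l01 H; have [bs <-] := unit_mean_step c d l01.
rewrite gamma_truncS // le_unit_mean //.
exact/bounded_measurable_stage/bounded_measurable_gamma_shift.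
Qed.

Lemma gamma_truncS_le1 xi j n c : valid_profile xi ->
  (forall a, stage r (first_quit xi a) (gamma_trunc r (shift a xi) j n) j <= c) ->
  gamma_trunc r xi j n.+1 <= c.
Proof.
move=> vxi H; have := @gamma_truncS_le xi j n 0 c c vxi.
by rewrite lexx ler01 mul0r add0r subr0 mul1r; apply=> // a; rewrite if_same.
Qed.

Lemma gamma_truncS_ge1 xi j n c : valid_profile xi ->
  (forall a, c <= stage r (first_quit xi a) (gamma_trunc r (shift a xi) j n) j) ->
  c <= gamma_trunc r xi j n.+1.
Proof.
move=> vxi H; have := @gamma_truncS_ge xi j n 0 c c vxi.
by rewrite lexx ler01 mul0r add0r subr0 mul1r; apply=> // a; rewrite if_same.
Qed.

Lemma in_cube_single i theta : 0 <= theta <= 1 -> in_cube (subst (fun=> 0 : R) i theta).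
Proof. by move=> t01; apply: in_cube_subst => // k; rewrite lexx ler01. Qed.

Lemma subst_single0 i : subst (fun=> 0 : R) i 0 = (fun=> 0).
Proof. exact: (subst_id (fun=> 0 : R) i). Qed.

Lemma pquit0_single i theta : pquit (subst (fun=> 0 : R) i theta) finset.set0 = 1 - theta.
Proof. by rewrite pquit0_subst big1 ?mulr1 // => k _; rewrite subr0. Qed.

Lemma pquit_single1 i (S : {set 'I_N}) :
  pquit (subst (fun=> 0 : R) i 1) S = (S == finset.set1 i)%:R.
Proof.
have [->|Si] := eqVneq S (finset.set1 i).
  rewrite pquit_subst !inE eqxx mul1r big1 // => k ki.
  by rewrite inE (negbTE ki) subr0.
rewrite pquit_subst; have [iS|iS] := boolP (i \in S); last by rewrite subrr mul0r.
have [k kS ki] : exists2 k, k \in S & k != i.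
  apply/exists_inP; apply: contraNT Si; rewrite negb_exists_in => /forall_inP Sk.
  apply/eqP/setP => k; rewrite inE; apply/idP/eqP => [/Sk|->] //.
  by rewrite negbK => /eqP.
by rewrite (bigD1 k) //= kS mul0r mulr0.
Qed.

Lemma stage_idle c j : stage r (fun=> 0) c j = c.
Proof.
rewrite /stage big1 ?add0r => [|S /set0Pn[k kS]]; last first.
  by rewrite pquitE (bigD1 k) //= kS !mul0r.
by rewrite pquit0 big1 ?mul1r // => k _; rewrite subr0.
Qed.

Lemma stage_single i theta c j : stage r (subst (fun=> 0) i theta) c j =
  theta * r (finset.set1 i) j + (1 - theta) * c.
Proof.
rewrite stage_affine subst_single0 stage_idle; congr (_ * _ + _).
rewrite /stage (bigD1 (finset.set1 i)) /=; last by apply/set0Pn; exists i; rewrite inE.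
rewrite pquit_single1 eqxx mul1r big1 ?addr0 => [|S /andP[_ /negbTE Si]].
  by rewrite pquit0_single subrr mul0r addr0.
by rewrite pquit_single1 Si mul0r.
Qed.

Hypothesis r_bound : forall S j, `|r S j| <= 2.
Hypothesis r_single : forall j, r (finset.set1 j) j = 0.

Let gt_bound xi j n : valid_profile xi -> `|gamma_trunc r xi j n| <= 2.
Proof. by move=> vxi; apply: gamma_trunc_bound. Qed.

(** When the others never quit, quitting pays 0 and never quitting pays [r finset.set0 j]; a
    deviation only mixes the two. *)
Lemma idle_deviation u : (forall j, u j = Num.max (r finset.set0 j) 0) ->
  deviation_bound (@idle R N) u 0.
Proof.
move=> uE; exists 0%N => n j eta _; rewrite addr0.
have u0 : 0 <= u j by rewrite uE le_max lexx orbT.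
elim: n eta => [|n IH] eta veta; first by rewrite gamma_trunc0 uE le_max lexx.
apply: gamma_truncS_le1 => [|a]; first exact: valid_deviate (@valid_idle R N) veta.
rewrite shift_deviate first_quit_deviate.
have -> : first_quit (@idle R N) a = (fun=> 0) by [].
rewrite stage_single r_single mulr0 add0r.
have /andP[y0 y1] := (veta 0%N).2 [tuple a].
have := IH _ (valid_shift_strat a veta).
have -> : shift a (@idle R N) = @idle R N by [].
by set y := eta _ _ in y0 y1 *; set g := gamma_trunc _ _ _ _ => gu; nra.
Qed.

Lemma idle_payoff j n : gamma_trunc r (@idle R N) j n = r finset.set0 j.
Proof.
elim: n => [|n IH]; first by rewrite gamma_trunc0.
rewrite gamma_truncS; last exact: valid_idle.
rewrite -[RHS](unit_mean_cst (r finset.set0 j)); congr unit_mean; apply/funext => a.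
by rewrite stage_idle.
Qed.

(** Only [iota] is added to [e]. Quitting now pays another player at most [2 * theta], which
    [- slack <= v j] and [slack + 2 * theta <= e] cover; for [i] quitting pays 0 and
    [v i = (1 - theta) * u i] is within [iota] of 0. The shortfall [s] counts only if [i] does not
    quit. *)
Lemma explicit_step xi u e s i theta slack iota : valid_profile xi ->
  deviation_bound xi u e -> payoff_bound xi u s -> `|u i| <= iota ->
  0 <= theta <= 1 -> 0 <= e -> slack + 2 * theta <= e ->
  let v j := theta * r (finset.set1 i) j + (1 - theta) * u j in
  (forall j, - slack <= v j) ->
  deviation_bound (pcons (subst (fun=> 0) i theta) xi) v (e + iota) /\
  payoff_bound (pcons (subst (fun=> 0) i theta) xi) v ((1 - theta) * s).
Proof.
move=> vxi [n1 dev] [n2 pay] ui t01 e0 ee v vl.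
have cx := in_cube_single i t01; have vp := valid_pcons cx vxi.
move: (t01) => /andP[t0 t1]; move: (ui); rewrite ler_norml => /andP[ui1 ui2].
split.
  exists n1.+1 => -[//|n] j eta nn veta; apply: gamma_truncS_le1 => [|a].
    exact: valid_deviate.
  rewrite shift_deviate first_quit_deviate shift_pcons first_quit_pcons.
  have /andP[y0 y1] := (veta 0%N).2 [tuple a].
  have := dev n j _ nn (valid_shift_strat a veta).
  set c := gamma_trunc _ _ _ _ => cu; set y := eta _ _ in y0 y1 *.
  rewrite stage_affine.
  have vj : - slack <= v j by exact: vl.
  have [Qb Cb] : stage r (subst (subst (fun=> 0) i theta) j 1) c j <= v j + (e + iota) /\
      stage r (subst (subst (fun=> 0) i theta) j 0) c j <= v j + (e + iota).
    have [ji|ji] := eqVneq j i.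
      have vi : v i = (1 - theta) * u i by rewrite /v r_single mulr0 add0r.
      move: cu; rewrite ji !substK !stage_single r_single vi => cu.
      by split; nra.
    split.
      have := stage_quit_small r_bound r_single c j cx.
      rewrite pquit0_single ler_norml => /andP[_]; lra.
    have -> : subst (subst (fun=> 0 : R) i theta) j 0 = subst (fun=> 0) i theta.
      have E0 : subst (fun=> 0 : R) i theta j = 0 by rewrite /subst (negbTE ji).
      by rewrite -[RHS](subst_id _ j) E0.
    rewrite stage_single /v; nra.
  set Q := stage _ _ _ _ in Qb *; set C := stage _ _ _ _ in Cb *; nra.
exists n2.+1 => -[//|n] j nn; apply: gamma_truncS_ge1 => // a.
rewrite shift_pcons first_quit_pcons stage_single /v.
have := pay n j nn; set c := gamma_trunc _ _ _ _; nra.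
Qed.

(** A deviation gains at most [delta] per stage of the phase, whose expected length is at most
    [1 / lam], hence [delta / lam]; the other half of [iota] covers truncation. *)
Lemma phase_step xi u e s lam delta iota x (V : 'I_N -> R) : valid_profile xi ->
  deviation_bound xi u e -> payoff_bound xi u s -> 0 <= s ->
  (forall j, 0 <= u j + e) -> 0 <= e -> (forall j, `|V j| <= 2) ->
  0 < lam < 1 -> 0 < delta -> delta / lam <= iota / 2 ->
  in_cube x -> (forall j, V j = lam * u j + (1 - lam) * stage r x (V j) j) ->
  (forall j, (x j < 1 -> stage r (subst x j 1) 0 j <= stage r (subst x j 0) (V j) j + delta) /\
      (0 < x j -> stage r (subst x j 0) (V j) j <= stage r (subst x j 1) 0 j + delta)) ->
  deviation_bound (phase lam x xi) V (e + iota) /\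
  payoff_bound (phase lam x xi) V
    (lam / (1 - (1 - lam) * pquit x finset.set0) * s + iota).
Proof.
move=> vxi [n1 dev] [n2 pay] s0 ue e0 V2 /andP[l0 l1] d0 di cx VE xP.
have vp := valid_phase lam cx vxi.
have l01 : 0 <= lam <= 1 by rewrite (ltW l0) (ltW l1).
have k0 : 0 < delta / lam by rewrite divr_gt0.
have iota0 : 0 < iota by lra.
(* Both [gamma_trunc] and [V] are bounded by 2, so they differ by at most 4; this matters only if no
   switching signal comes in [m] stages, an event of probability [(1 - lam) ^+ m]. *)
have [m0 m0P] : exists m0 : nat, forall m, (m0 <= m)%N -> 4 * (1 - lam) ^+ m <= iota / 2.
  have nl : `|1 - lam| < 1 by rewrite ltr_norml; apply/andP; split; lra.
  have i8 : 0 < iota / 8 by lra.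
  have /cvgrPdist_le/(_ _ i8)[m0 _ H] := @cvg_expr R _ nl.
  exists m0 => m /H /=; rewrite sub0r normrN ger0_norm ?exprn_ge0 ?subr_ge0 ?(ltW l1) //; lra.
set p := pquit x finset.set0.
have p0 : 0 <= p by exact: pquit_ge0.
have p1 : p <= 1 by exact: pquit_le1.
split.
  suff H m j eta : valid_strat eta ->
      gamma_trunc r (deviate (phase lam x xi) j eta) j (n1 + m)
        <= V j + (e + delta / lam + 4 * (1 - lam) ^+ m).
    exists (n1 + m0)%N => n j eta nn veta.
    have nm : (m0 <= n - n1)%N by rewrite leq_subRL // (leq_trans _ nn) // leq_addr.
    have := H (n - n1)%N j _ veta; rewrite subnKC ?(leq_trans _ nn) ?leq_addr //.
    have := m0P _ nm; lra.
  elim: m eta => [|m IH] eta veta.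
    have := gt_bound j (n1 + 0) (valid_deviate j vp veta).
    have := V2 j.
    rewrite !ler_norml expr0 => /andP[? ?] /andP[? ?]; lra.
  rewrite addnS; set E := e + delta / lam + 4 * (1 - lam) ^+ m.
  have E0 : 0 <= E.
    by rewrite addr_ge0 ?addr_ge0 ?divr_ge0 ?mulr_ge0 ?exprn_ge0 // ?subr_ge0 ltW.
  apply: (@le_trans _ _ (lam * (u j + e) + (1 - lam) * (stage r x (V j) j + delta + E))).
    apply: gamma_truncS_le => // [|a]; first exact: valid_deviate.
    rewrite shift_deviate first_quit_deviate shift_phase first_quit_phase.
    have /andP[y0 y1] := (veta 0%N).2 [tuple a].
    have veta' := valid_shift_strat a veta.
    set y := eta _ _ in y0 y1 *.
    (* On the switching signal the others are idle: quitting pays 0, covered by [0 <= u j + e], and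
       continuing leads to [xi]. *)
    case: ifP => _.
      rewrite stage_single r_single.
      have := dev (n1 + m)%N j _ (leq_addr _ _) veta'.
      by set c := gamma_trunc _ _ _ _ => cu; have := ue j; nra.
    have := IH _ veta'; rewrite -/E; set c := gamma_trunc _ _ _ _ => cV.
    have cx0 : in_cube (subst x j 0) by apply: in_cube_subst; rewrite ?lexx ?ler01.
    rewrite stage_affine (stage_quit r x j c 0).
    have := stage_homo r j cx0 cV; rewrite stageD.
    have := pquit_le1 finset.set0 cx0; have := pquit_ge0 finset.set0 cx0.
    have := stage_affine r x j (x j) (V j) j; rewrite subst_id (stage_quit r x j (V j) 0).
    have [h1 h2] := xP j; have /andP[x0 x1] := cx j.
    move: h1 h2; set q := pquit _ _; set Q := stage _ _ 0 _.
    set C := stage _ (subst x j 0) (V j) _; set Cc := stage _ _ c _; set w := stage _ x _ _.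
    move=> h1 h2 wE q0 q1 CcE.
    have qE : q * E <= E by rewrite ler_piMl.
    (* [w] averages [Q] and [C] with weights [x j] and [1 - x j]; an action of positive weight is at
       most [delta] worse than the other, so neither exceeds [w + delta]. *)
    have Cw : C <= w + delta.
      have [x00|x00] := ltrP 0 (x j); first by have := h2 x00; nra.
      by have -> : w = C; [rewrite wE (_ : x j = 0); [ring|apply/eqP; rewrite eq_le x00 x0] | lra].
    have Qw : Q <= w + delta.
      have [x11|x11] := ltrP (x j) 1; first by have := h1 x11; nra.
      by have -> : w = Q; [rewrite wE (_ : x j = 1); [ring|apply/eqP; rewrite eq_le x11 x1] | lra].
    have : Cc <= w + delta + E by lra.
    have : Q <= w + delta + E by lra.
    nra.
  have dl : delta = delta / lam * lam by rewrite divfK ?gt_eqF.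
  have := VE j; rewrite exprS /E; move: dl (ltW k0).
  set k := delta / lam; set w := stage _ _ _ _; set z := (1 - lam) ^+ m.
  move=> -> k0' ->; nra.
(* [rho] is the probability that the switching signal comes before anyone quits; [rhoE] conditions
   on one stage. *)
set rho := lam / _.
have den0 : 0 < 1 - (1 - lam) * p by nra.
have rhoE : lam + (1 - lam) * p * rho = rho.
  by rewrite /rho; field; rewrite gt_eqF.
suff H m j : V j - (rho * s + 4 * (1 - lam) ^+ m) <= gamma_trunc r (phase lam x xi) j (n2 + m).
  exists (n2 + m0)%N => n j nn.
  have nm : (m0 <= n - n2)%N by rewrite leq_subRL // (leq_trans _ nn) // leq_addr.
  have := H (n - n2)%N j; rewrite subnKC ?(leq_trans _ nn) ?leq_addr //.
  have := m0P _ nm; lra.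
have rho0 : 0 <= rho by rewrite divr_ge0 // ltW.
elim: m => [|m IH].
  have := gt_bound j (n2 + 0) vp; have := V2 j; have := mulr_ge0 rho0 s0.
  rewrite !ler_norml expr0 => ? /andP[? ?] /andP[? ?]; lra.
rewrite addnS; set F := rho * s + 4 * (1 - lam) ^+ m in IH.
apply: (@le_trans _ _ (lam * (u j - s) + (1 - lam) * (stage r x (V j) j - p * F))).
  have := VE j; rewrite exprS /F; set w := stage _ _ _ _; set z := (1 - lam) ^+ m => VjE.
  have z0 : 0 <= z by rewrite exprn_ge0 // subr_ge0 ltW.
  have pz : p * z <= z by rewrite ler_piMl.
  have : (1 - lam) * (p * z) <= (1 - lam) * z by rewrite ler_wpM2l // subr_ge0 ltW.
  have : (lam + (1 - lam) * p * rho) * s = rho * s by rewrite rhoE.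
  rewrite {1}VjE; lra.
apply: gamma_truncS_ge => // a.
rewrite shift_phase first_quit_phase; case: ifP => _.
  by rewrite stage_idle; apply: pay; rewrite leq_addr.
by have := stage_homo r j cx IH; rewrite stageD mulrN.
Qed.

End Equilibrium.

(** * The backward construction *)

Section Loop.
Variables (R : realType) (N : nat) (r : {set 'I_N} -> 'I_N -> R).
Implicit Types (xi : profile R N) (x u V : 'I_N -> R) (i j : 'I_N).
Implicit Types (e s lam theta iota delta slack beta kappa eps : R).
Hypothesis r_bound : forall S j, `|r S j| <= 2.
Hypothesis r_single : forall j, r (finset.set1 j) j = 0.

(* Player i, being almost indifferent, can be asked to quit next.  The vector u is
   not the payoff of xi: at the end of play it stands for max (r set0 j) 0, which
   bounds the deviations there. *)
Definition labelled slack iota e s := exists xi u i,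
  [/\ valid_profile xi, forall j, - slack <= u j <= 2, `|u i| <= iota,
      deviation_bound r xi u e & payoff_bound r xi u s].

(** The same [i] stays nearly indifferent: as quitting alone pays 0, its coordinate shrinks by the
    factor [1 - theta]. *)
Lemma labelled_explicit slack iota e s theta xi u i : valid_profile xi ->
  (forall j, - slack <= u j <= 2) -> `|u i| <= iota ->
  deviation_bound r xi u e -> payoff_bound r xi u s ->
  0 <= theta <= 1 -> 0 <= slack -> slack + 2 * theta <= e ->
  (forall j, - slack <= theta * r (finset.set1 i) j + (1 - theta) * u j) ->
  labelled slack iota (e + iota) ((1 - theta) * s).
Proof.
move=> vxi ub ui dev pay t01 sl0 ee vl; have /andP[t0 t1] := t01.
have e0 : 0 <= e by lra.
have [dev' pay'] := explicit_step r_bound r_single vxi dev pay ui t01 e0 ee vl.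
eexists; eexists; exists i; split; [|move=> j| |exact: dev'|exact: pay'].
- by apply: valid_pcons => //; exact: in_cube_single.
- rewrite vl /=; have := r_bound (finset.set1 i) j; rewrite ler_norml => /andP[_ r2].
  by have /andP[_ u2] := ub j; nra.
- rewrite /= r_single mulr0 add0r normrM ger0_norm ?subr_ge0 //.
  by rewrite (le_trans _ ui) // ler_piMl // gerBl.
Qed.

(** If [V j] exceeded 2 in absolute value, it would average numbers no larger than itself, one of
    them strictly smaller with weight [lam]. *)
Lemma stationary_value_bound u lam x V j : 0 < lam < 1 -> in_cube x -> `|u j| <= 2 ->
  V j = lam * u j + (1 - lam) * stage r x (V j) j -> `|V j| <= 2.
Proof.
move=> /andP[l0 l1] cx u2 VE; rewrite leNgt; apply/negP => V2.
have st : `|stage r x (V j) j| <= `|V j|.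
  by apply: stage_bound => // S; rewrite (le_trans (r_bound S j)) // ltW.
have : `|V j| <= lam * `|u j| + (1 - lam) * `|stage r x (V j) j|.
  rewrite {1}VE (le_trans (ler_normD _ _)) // !normrM.
  by rewrite (gtr0_norm l0) (@gtr0_norm _ (1 - lam)) ?subr_gt0.
by move: u2 V2 st; set a := `|u j|; set b := `|V j|; set c := `|stage _ _ _ _|; nra.
Qed.

(* If x rarely ends the game, then each x_j is small, so quitting pays about 0. *)
Lemma small_stationary x V kappa delta : in_cube x -> 0 < kappa <= 1/2 -> 0 <= delta ->
  1 - pquit x finset.set0 <= kappa ->
  (forall j, (x j < 1 -> stage r (subst x j 1) 0 j <= stage r (subst x j 0) (V j) j + delta) /\
      (0 < x j -> stage r (subst x j 0) (V j) j <= stage r (subst x j 1) 0 j + delta)) ->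
  (forall j, - (2 * (4 * kappa + delta)) <= V j) /\
  (forall i, 0 < x i -> `|V i| <= 2 * (4 * kappa + delta)).
Proof.
move=> cx /andP[k0 k1] d0 pk xP.
have H j : - (2 * (4 * kappa + delta)) <= V j /\
    (0 < x j -> V j <= 2 * (4 * kappa + delta)).
  have := stage_quit_small r_bound r_single 0 j cx.
  have := stage_continue_small r_bound (V j) j cx.
  have := pquit0_subst0_ge j cx.
  have cx0 : in_cube (subst x j 0) by apply: in_cube_subst; rewrite ?lexx ?ler01.
  have := pquit_le1 finset.set0 cx0.
  have xj1 : x j < 1.
    have /andP[x0 x1] := cx j; rewrite lt_neqAle x1 andbT; apply/eqP => x1'.
    move: pk; rewrite -(subst_id x j) pquit0_subst x1' subrr mul0r; lra.
  have [/(_ xj1) h1 h2] := xP j; move: h1 h2.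
  set q := pquit (subst _ _ _) _; set p := pquit x _ in pk *.
  set Q := stage _ _ 0 _; set C := stage _ _ (V j) _; set v := V j.
  rewrite !ler_norml => h1 h2 q1 qp /andP[c1 c2] /andP[q3 q4].
  (* This gives the factor 2; in [4 * kappa], half is the error of quitting and half that of
     continuing. *)
  have qh : 1/2 <= q by lra.
  split.
    have [v0|v0] := lerP 0 v; first lra.
    have qv : - (4 * kappa + delta) <= q * v by lra.
    nra.
  move=> /h2 h3; have [v0|v0] := lerP v 0; first lra.
  have qv : q * v <= 4 * kappa + delta by lra.
  nra.
split=> [j|i xi0]; first by case: (H j).
by have [h1 /(_ xi0) h2] := H i; rewrite ler_norml h1 h2.
Qed.

(** One round: either [s] shrinks by [1 - theta] up to [iota], or a phase that nearly always ends
    the game shrinks it to about [beta * s] and the construction stops. *)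
Lemma loop_step slack theta iota beta e s :
  0 < slack <= 1 -> 0 < theta <= slack / 4 -> 0 < iota <= slack / 2 -> 0 < beta <= 1 ->
  slack + 2 * theta <= e -> 0 <= s -> labelled slack iota e s ->
  labelled slack iota (e + 2 * iota) ((1 - theta) * s + iota) \/
  exists xi u, [/\ valid_profile xi, deviation_bound r xi u (e + iota)
    & payoff_bound r xi u (beta * s + iota)].
Proof.
move=> /andP[sl0 sl1] /andP[t0 t1] /andP[i0 i1] /andP[b0 b1] ee s0.
move=> [xi [u [i [vxi ub ui dev pay]]]].
have t01 : 0 <= theta <= 1 by apply/andP; split; lra.
have weaken e' s' : e' <= e + 2 * iota -> s' <= (1 - theta) * s + iota ->
    labelled slack iota e' s' -> labelled slack iota (e + 2 * iota) ((1 - theta) * s + iota).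
  move=> le_e le_s [xi' [u' [i' [h1 h2 h3 h4 h5]]]]; exists xi', u', i'; split=> //.
    exact: deviation_boundW h4.
  exact: payoff_boundW h5.
have [vl|] := pselect (forall j, - slack <= theta * r (finset.set1 i) j + (1 - theta) * u j).
  left; apply: (weaken (e + iota) ((1 - theta) * s)); [lra|lra|].
  exact: (labelled_explicit vxi ub ui dev pay t01 (ltW sl0) ee vl).
move=> /existsNP[k /negP]; rewrite -ltNge => uk.
(* As [theta <= slack / 4], the term [theta * r] accounts for at most half of the drop below
   [- slack]. *)
have {}uk : u k < - (slack / 2).
  have := r_bound (finset.set1 i) k; rewrite ler_norml => /andP[r1 _].
  rewrite ltNge; apply/negP => uk'; move: uk; rewrite ltNge => /negP; apply; nra.
(* [kappa] and [delta] make the bound of [small_stationary] at most [iota]; [lam = beta * kappa]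
   turns [beta < rho] into [1 - p <= kappa]. *)
pose kappa := iota / 32; pose lam := beta * kappa; pose delta := lam * (iota / 4).
have k01 : 0 < kappa <= 1/2 by rewrite /kappa; apply/andP; split; lra.
have l01 : 0 < lam < 1.
  move: k01 => /andP[k0 k1]; rewrite /lam mulr_gt0 //=.
  have := ler_wpM2r (ltW k0) b1; rewrite mul1r; lra.
have /andP[l0 l1] := l01.
have d0 : 0 < delta by rewrite /delta mulr_gt0 // divr_gt0.
have dl : delta / lam <= iota / 2.
  rewrite /delta mulrAC divff ?gt_eqF // mul1r; lra.
have [x [V [cx VE xP]]] := stationary_equilibrium r u l01 d0.
have u2 j : `|u j| <= 2.
  by have /andP[? ?] := ub j; rewrite ler_norml; apply/andP; split; lra.
have V2 j : `|V j| <= 2 by exact: (stationary_value_bound l01 cx (u2 j) (VE j)).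
have ue j : 0 <= u j + e by have /andP[? _] := ub j; lra.
have e0 : 0 <= e by lra.
have [dev' pay'] := phase_step r_bound r_single vxi dev pay s0 ue e0 V2 l01 d0 dl cx VE xP.
have vp := valid_phase lam cx vxi.
set p := pquit x finset.set0 in pay'; set rho := lam / _ in pay'.
have p1 : p <= 1 by exact: pquit_le1.
have p0 : 0 <= p by exact: pquit_ge0.
have den0 : 0 < 1 - (1 - lam) * p by nra.
have rho1 : rho <= 1 by rewrite /rho ler_pdivrMr // mul1r; nra.
have [rb|rb] := lerP rho beta.
  right; exists (phase lam x xi), V; split=> //.
  by apply: payoff_boundW pay'; rewrite lerD2r ler_wpM2r.
left.
have pk : 1 - p <= kappa.
  move: rb; rewrite /rho ltr_pdivlMr // /lam ltr_pM2l // => rb.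
  by apply: ltW; apply: (le_lt_trans _ rb); rewrite /lam in l0 l1 *; nra.
have [Vlow Vlab] := small_stationary cx k01 (ltW d0) pk xP.
have small : 2 * (4 * kappa + delta) <= iota.
  have : delta <= iota / 4 by rewrite /delta ler_piMl // ?ltW // divr_gt0.
  rewrite /kappa; lra.
(* If [x] were 0, then [V = u], but [V k >= - iota >= - slack / 2 > u k]. *)
have [l lP] : exists l, 0 < x l.
  apply: contrapT => /forallNP xn.
  have x0 : x = (fun=> 0).
    apply/funext => j; apply/eqP; rewrite eq_le; have /andP[-> _] := cx j.
    by rewrite andbT leNgt; apply/negP/xn.
  have := VE k; rewrite x0 stage_idle => Vk.
  have Vu : lam * V k = lam * u k by lra.
  have {Vk}Vu : V k = u k by apply: (mulfI _ Vu); rewrite gt_eqF.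
  have := Vlow k; rewrite Vu; lra.
(* A stage where [l] may quit is prepended at once, so a round with a phase also shrinks [s];
   [V >= - slack / 2] and [theta <= slack / 4] allow it. *)
apply: (weaken (e + iota + iota) ((1 - theta) * (rho * s + iota))).
- lra.
- by have : rho * s <= s by [rewrite ler_piMl]; nra.
apply: (labelled_explicit vp _ (le_trans (Vlab _ lP) small) dev' pay' t01 (ltW sl0)).
- move=> j; have := Vlow j; have := V2 j; rewrite ler_norml => /andP[_ ->] Vj.
  by rewrite andbT; lra.
- lra.
move=> j; have := r_bound (finset.set1 l) j; rewrite ler_norml => /andP[r1 _].
have := Vlow j; nra.
Qed.

Lemma normalized_sunspot eps : 0 < eps <= 1 -> exists xi, sunspot_eq r eps xi.
Proof.
move=> /andP[eps0 eps1].
have [r0|] := pselect (forall j, 0 <= r finset.set0 j).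
  exists (@idle R N); apply: (@sunspot_eq_of_bounds _ _ r _ (r finset.set0) 0 0).
  - exact: valid_idle.
  - by apply: idle_deviation => // j; rewrite max_l.
  - by exists 0%N => n j _; rewrite subr0 idle_payoff.
  - by rewrite addr0 ltW.
move=> /existsNP[i /negP]; rewrite -ltNge => ri.
(* In units of [eps / 16], [e0] is 3 and the accumulated [iota] terms at most 3; the rest of [s]
   adds 2 after [K] rounds, or a stopping phase adds at most 3 and two more [iota]. *)
pose slack := eps / 8; pose theta := eps / 32; pose beta := eps / 16.
pose e0 := slack + 2 * theta.
have t01 : 0 < theta < 1 by rewrite /theta; apply/andP; split; lra.
have /andP[t0 t1] := t01.
have [K KP] : exists K : nat, 2 * (1 - theta) ^+ K <= eps / 8.
  have nl : `|1 - theta| < 1 by rewrite ltr_norml; apply/andP; split; lra.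
  have i16 : 0 < eps / 16 by lra.
  have /cvgrPdist_le/(_ _ i16)[m _ /(_ m (leqnn m))] := @cvg_expr R _ nl.
  rewrite /= sub0r normrN ger0_norm ?exprn_ge0 ?subr_ge0 ?(ltW t1) // => H.
  by exists m; lra.
(* Each of at most [K] rounds adds [2 * iota] to [e] and [iota] to [s]; [K.+1] avoids division by
   0. *)
pose iota := eps / 16 / K.+1%:R.
have K0 : 1 <= K.+1%:R :> R by rewrite ler1n.
have i0 : 0 < iota by rewrite divr_gt0 // ?ltr0n //; lra.
have iK k : (k <= K)%N -> k%:R * iota <= eps / 16.
  move=> kK; have -> : eps / 16 = K.+1%:R * iota.
    by rewrite /iota [RHS]mulrC divfK // pnatr_eq0.
  by rewrite ler_pM2r // ler_nat (leq_trans kK).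
have i1 : iota <= eps / 16 by rewrite /iota ler_pdivrMr ?ltr0n // ler_peMr //; lra.
have main k : (k <= K)%N ->
    labelled slack iota (e0 + k%:R * (2 * iota)) (2 * (1 - theta) ^+ k + k%:R * iota) \/
    exists xi, sunspot_eq r eps xi.
  elim: k => [_|k IH kK].
    (* The idle end: the player [i] with [r finset.set0 i < 0] has coordinate 0, and obeying falls
       short of this vector by at most 2. *)
    left; exists (@idle R N), (fun j => Num.max (r finset.set0 j) 0), i; split.
    - exact: valid_idle.
    - move=> j; have := r_bound finset.set0 j; rewrite ler_norml => /andP[_ r2].
      by rewrite le_max ge_max r2 /slack; apply/andP; split; [apply/orP; right; lra|lra].
    - by rewrite /= max_r ?(ltW ri) // normr0 (ltW i0).
    - apply: (@deviation_boundW _ _ _ _ _ 0); last exact: idle_deviation.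
      by rewrite /e0 /slack mul0r addr0; lra.
    - exists 0%N => n j _; rewrite idle_payoff expr0 mulr1 mul0r addr0.
      have := r_bound finset.set0 j; rewrite ler_norml => /andP[r1 _].
      by rewrite lerBlDr ge_max lerDl; apply/andP; split; lra.
  have [lab|] := IH (ltnW kK); last by right.
  set e := e0 + _ in lab; set s := 2 * _ + _ in lab.
  have z0 : 0 <= (1 - theta) ^+ k by rewrite exprn_ge0 // subr_ge0 ltW.
  have z1 : (1 - theta) ^+ k <= 1 by apply: exprn_ile1; lra.
  have k0 : 0 <= k%:R * iota by rewrite mulr_ge0 // ltW.
  have kE := iK k (ltnW kK).
  have s0 : 0 <= s by rewrite /s; lra.
  have s3 : s <= 3 by rewrite /s; lra.
  have ee : slack + 2 * theta <= e by rewrite /e /e0; lra.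
  have sl : 0 < slack <= 1 by rewrite /slack; apply/andP; split; lra.
  have tl : 0 < theta <= slack / 4 by rewrite t0 /slack /theta; lra.
  have il : 0 < iota <= slack / 2 by rewrite i0 /slack; lra.
  have bl : 0 < beta <= 1 by rewrite /beta; apply/andP; split; lra.
  have [lab'|[xi [u [vxi dev pay]]]] := loop_step sl tl il bl ee s0 lab.
    left; move: lab' => [xi [u [l [h1 h2 h3 h4 h5]]]]; exists xi, u, l; split=> //.
      apply: deviation_boundW h4; rewrite /e -natr1; lra.
    apply: payoff_boundW h5; rewrite /s exprS -natr1.
    have : 0 <= theta * (k%:R * iota) by rewrite mulr_ge0 // ltW.
    lra.
  right; exists xi; apply: sunspot_eq_of_bounds vxi dev pay _.
  have : beta * s <= beta * 3 by rewrite ler_pM2l //; case/andP: bl.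
  rewrite /e /e0 /slack /theta /beta; lra.
have [|[xi [u [l [vxi _ _ dev pay]]]]|//] := main K; first exact: leqnn.
exists xi; apply: sunspot_eq_of_bounds vxi dev pay _.
have := iK K (leqnn K); rewrite /e0 /slack /theta; lra.
Qed.

End Loop.

(** * Removing the normalization *)

(** The outcome probabilities, that of never quitting included, sum to 1. *)
Lemma gamma_sub_cst (R : realType) (N : nat) (r : {set 'I_N} -> 'I_N -> R) (c : 'I_N -> R)
    (xi : profile R N) (j : 'I_N) : valid_profile xi ->
  gamma (fun S j => r S j - c j) xi j = gamma r xi j - c j.
Proof.
move=> vxi; rewrite /gamma.
have -> : gamma_trunc (fun S j => r S j - c j) xi j = (fun n => gamma_trunc r xi j n - c j).
  apply/funext => n; rewrite !gamma_truncE /= addrAC; congr (_ + _ + _).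
  apply: eq_bigr => t _; apply: eq_bigr => S _.
  by rewrite opprB addrA subrK.
have cg := @cvg_gamma_trunc _ _ r xi j vxi.
apply: cvg_lim => //; apply: cvgB => //; exact: cvg_cst.
Qed.

Theorem theorem1 (R : realType) (N : nat) (r : {set 'I_N} -> 'I_N -> R)
  (hr : forall (S : {set 'I_N}) (i : 'I_N), -1 <= r S i <= 1)
  (eps : R) (heps : 0 < eps) :
  exists xi : profile R N, sunspot_eq r eps xi.
Proof.
(* After this shift quitting alone pays 0, and payoffs are bounded by 2. *)
pose c j := r (finset.set1 j) j.
have rb S j : `|r S j - c j| <= 2.
  have /andP[a1 a2] := hr S j; have /andP[b1 b2] := hr (finset.set1 j) j.
  by rewrite /c ler_norml; apply/andP; split; lra.
have rs j : r (finset.set1 j) j - c j = 0 by rewrite subrr.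
have m01 : 0 < Num.min eps 1 <= 1 by rewrite lt_min heps ltr01 ge_min lexx orbT.
have [xi [vxi eq_xi]] := normalized_sunspot rb rs m01.
exists xi; split=> // j eta veta.
have := eq_xi j eta veta; rewrite !gamma_sub_cst //; last exact: valid_deviate.
have : Num.min eps 1 <= eps by rewrite ge_min lexx.
set g := gamma r (deviate _ _ _) _; set h := gamma r xi j; lra.
Qed.
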